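(* Let $\alpha,\beta>0$. The power Lindley distribution $PL(\alpha,\beta)$ is moment-indeterminate if and only if $\alpha<1/2$.
   Context: For $\alpha,\beta>0$, the power Lindley distribution $PL(\alpha,\beta)$ is the probability distribution on $\mathbb{R}$ with density $f(x)=\frac{\alpha\beta^2}{\beta+1}\left(1+x^\alpha\right)x^{\alpha-1}e^{-\beta x^\alpha}$ for $x>0$ and $f(x)=0$ for $x\le 0$. All its moments are finite. A probability distribution on $\mathbb{R}$ with finite moments of all orders is called moment-determinate if it is the only probability distribution on $\mathbb{R}$ having its sequence of moments, and moment-indeterminate otherwise. *)

(* Defs.v *)
From HB Require Import structures.
From mathcomp Require Import all_boot all_order all_algebra.
From mathcomp Require Import ring lra.
From mathcomp Require Import interval_inference.
From mathcomp Require Import all_classical all_reals all_analysis.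
From mathcomp Require Import measurable_realfun.

Set Implicit Arguments.
Unset Strict Implicit.
Unset Printing Implicit Defensive.

Import Order.TTheory GRing.Theory Num.Theory.
Import numFieldNormedType.Exports.

Local Open Scope classical_set_scope.
Local Open Scope ring_scope.

Definition power_lindley_pdf (R : realType) (alpha beta x : R) : R :=
  if 0 < x then
    alpha * beta ^+ 2 / (beta + 1) * (1 + x `^ alpha) * x `^ (alpha - 1) *
    expR (- beta * x `^ alpha)
  else 0.

Section power_lindley_pdf_theory.
Context {R : realType}.
Variables (alpha beta : R).
Hypotheses (alpha_gt0 : 0 < alpha) (beta_gt0 : 0 < beta).
Notation mu := lebesgue_measure.
Local Notation pdf := (power_lindley_pdf alpha beta).

Let b1_gt0 : 0 < beta + 1. Proof. by rewrite addr_gt0. Qed.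

Lemma power_lindley_pdf_ge0 x : 0 <= pdf x.
Proof.
rewrite /power_lindley_pdf; case: ifPn => // x0.
rewrite !mulr_ge0 ?expR_ge0 ?powR_ge0 ?addr_ge0 ?invr_ge0 ?powR_ge0 ?ltW//.
Qed.

Lemma measurable_power_lindley_pdf : measurable_fun [set: R] pdf.
Proof.
apply: measurable_fun_ifT => //.
  by apply: measurable_fun_ltr; [exact: measurable_cst|exact: measurable_id].
apply: measurable_funM; first apply: measurable_funM; first apply: measurable_funM.
- exact: measurable_cst.
- by apply: measurable_funD => //; exact: measurable_powR.
- exact: measurable_powR.
- by apply: measurableT_comp => //; exact: measurable_funM.
Qed.

Let G (x : R) := - ((1 + beta / (beta + 1) * x `^ alpha) * expR (- beta * x `^ alpha)).

Let is_derive_powR (x : R) : 0 < x ->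
  is_derive x (1 : R) (fun y : R => y `^ alpha) (alpha * x `^ (alpha - 1)).
Proof.
move=> x0; have xi : x \in `]0, +oo[ by rewrite in_itv/= x0.
apply: DeriveDef; first exact: derivable_powR.
by rewrite -derive1E powR_derive1.
Qed.

Let is_derive_G (x : R) : 0 < x -> is_derive x (1 : R) G (pdf x).
Proof.
move=> x0; have dp := is_derive_powR x0.
rewrite /G; apply: is_derive_eq.
rewrite /power_lindley_pdf x0 /= /GRing.scale/=.
by field; rewrite gt_eqF.
Qed.

Let pdf_continuous (x : R) : 0 < x -> {for x, continuous pdf}.
Proof.
move=> x0.
have cp p : {for x, continuous (fun y : R => y `^ p)}.
  apply: differentiable_continuous; apply/derivable1_diffP.
  by apply: derivable_powR; rewrite in_itv/= x0.
suff : {for x, continuous (fun x : R => alpha * beta ^+ 2 / (beta + 1) *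
    (1 + x `^ alpha) * x `^ (alpha - 1) * expR (- beta * x `^ alpha))}.
  move=> h; rewrite /prop_for /continuous_at.
  have -> : pdf x = alpha * beta ^+ 2 / (beta + 1) *
    (1 + x `^ alpha) * x `^ (alpha - 1) * expR (- beta * x `^ alpha).
    by rewrite /power_lindley_pdf x0.
  apply: cvg_trans h; apply: near_eq_cvg; near=> y.
  rewrite /power_lindley_pdf; suff -> : 0 < y by [].
  by near: y; exact: lt_nbhsr.
apply: continuousM; first apply: continuousM; first apply: continuousM.
- exact: cst_continuous.
- by apply: continuousD; [exact: cst_continuous|exact: cp].
- exact: cp.
- apply: continuous_comp; last exact: continuous_expR.
  by apply: continuousM; [exact: cst_continuous|exact: cp].
Unshelve. all: end_near. Qed.

Let G_cvgy : G x @[x --> +oo%R] --> (0 : R).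
Proof.
have H : (fun u : R => - ((1 + beta / (beta + 1) * u) * expR (- beta * u))) x
    @[x --> +oo%R] --> (0 : R).
  apply/cvgrPdist_le => e e0; near=> u.
  have u0 : 0 < u by near: u; exact: nbhs_pinfty_gt.
  rewrite sub0r opprK ger0_norm; last first.
    by rewrite mulr_ge0 ?expR_ge0// addr_ge0// mulr_ge0 ?divr_ge0 ?ltW.
  have c1 : beta / (beta + 1) * u <= u.
    by rewrite ler_piMl ?ltW// ltr_pdivrMr// mul1r ltrDl.
  have := @expR_ge1Dxn R (beta * u) 1%N (mulr_ge0 (ltW beta_gt0) (ltW u0)).
  rewrite (_ : 2`! = 2)%N// => hE.
  rewrite mulNr expRN ler_pdivrMr ?expR_gt0//.
  apply: (@le_trans _ _ (e * ((beta * u) ^+ 2 / 2))); last first.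
    rewrite ler_pM2l//; apply: le_trans hE; by rewrite lerDr.
  apply: (@le_trans _ _ (2 * u)).
    have : 1 <= u by near: u; exact: nbhs_pinfty_ge.
    lra.
  have hu : 4 / (e * beta ^+ 2) <= u by near: u; apply: nbhs_pinfty_ge; rewrite num_real.
  rewrite ler_pdivrMr ?mulr_gt0 ?exprn_gt0// in hu.
  have -> : e * ((beta * u) ^+ 2 / 2) = (u * (e * beta ^+ 2)) * u / 2 by field.
  rewrite ler_pdivlMr//.
  rewrite (_ : 2 * u * 2 = 4 * u); last by ring.
  by rewrite ler_pM2r.
have py : x `^ alpha @[x --> +oo%R] --> +oo%R.
  apply/cvgryPge => A; near=> x.
  have [A0|A0] := leP A 0; first by rewrite (le_trans A0)// powR_ge0.
  have x0 : 0 < x by near: x; exact: nbhs_pinfty_gt.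
  have : A `^ alpha^-1 <= x by near: x; apply: nbhs_pinfty_ge; rewrite num_real.
  move=> /(ge0_ler_powR (ltW alpha_gt0)); rewrite !nnegrE powR_ge0 (ltW x0).
  move=> /(_ isT isT); rewrite -powRrM mulVf ?gt_eqF// powRr1//.
  exact: ltW.
exact: (cvg_comp _ _ py H).
Unshelve. all: end_near. Qed.

Let G_cvg0 : G x @[x --> 0^'+] --> (-1 : R).
Proof.
have p0 := @powR_cvg0 R alpha alpha_gt0.
have -> : (-1 : R) = - ((1 + beta / (beta + 1) * 0) * expR (- beta * 0)).
  by rewrite !mulr0 expR0 addr0 mulr1.
apply: cvgN; apply: cvgM.
  by apply: cvgD; [exact: cvg_cst|apply: cvgM => //; exact: cvg_cst].
apply: continuous_cvg; first exact: continuous_expR.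
by apply: cvgM => //; exact: cvg_cst.
Qed.

Let integral_pdf_itv (n : nat) :
  (\int[mu]_(x in `[(n.+1%:R^-1)%R, +oo[) (pdf x)%:E = (- G n.+1%:R^-1)%:E)%E.
Proof.
have n0 : 0 < n.+1%:R^-1 :> R by rewrite invr_gt0.
rewrite (@ge0_continuous_FTC2y _ pdf G _ 0).
- by rewrite sub0e EFinN.
- by move=> x _; exact: power_lindley_pdf_ge0.
- apply/continuous_within_itvcyP; split.
    move=> x; rewrite in_itv/= andbT => nx.
    by apply: pdf_continuous; exact: lt_trans nx.
  by apply: cvg_at_right_filter; exact: pdf_continuous.
- exact: G_cvgy.
- by move=> x nx; have [] := is_derive_G (lt_trans n0 nx).
- apply: cvg_at_right_filter.
  have := is_derive_G n0 => dG.
  by apply: differentiable_continuous; apply/derivable1_diffP.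
- move=> x; rewrite in_itv/= andbT => nx.
  have dG := is_derive_G (lt_trans n0 nx).
  by rewrite derive1E derive_val.
Qed.

Lemma integral_power_lindley_pdf : (\int[mu]_x (pdf x)%:E = 1)%E.
Proof.
have mpdf : measurable_fun [set: R] (EFin \o pdf).
  by apply/measurable_EFinP; exact: measurable_power_lindley_pdf.
have -> : (\int[mu]_x (pdf x)%:E = \int[mu]_(x in `]0%R, +oo[) (pdf x)%:E)%E.
  rewrite [RHS]integral_mkcond; apply: eq_integral => x _.
  rewrite patchE; case: ifPn => //; rewrite notin_setE/= in_itv/= andbT.
  by move=> /negP x0; rewrite /power_lindley_pdf (negbTE x0).
have -> : `]0, +oo[%classic = \bigcup_n `[n.+1%:R^-1, +oo[%classic :> set R.
  apply/seteqP; split => x /=; rewrite ?in_itv/= ?andbT.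
    move=> x0; have := @ltr_add_invr R 0 x x0 => -[k].
    rewrite add0r => kx; exists k => //=.
    by rewrite in_itv/= andbT ltW.
  by move=> [k _] /=; rewrite in_itv/= andbT; apply: lt_le_trans; rewrite invr_gt0.
pose F n : set R := `[(n.+1%:R^-1)%R, +oo[%classic.
rewrite -/(\bigcup_n F n).
have h1 : (\int[mu]_(x in F n) (pdf x)%:E)%E @[n --> \oo] -->
   (\int[mu]_(x in \bigcup_n F n) (pdf x)%:E)%E.
  have := @ge0_nondecreasing_set_cvg_integral _ (measurableTypeR R) R F (EFin \o pdf) mu.
  apply.
  - apply/nondecreasing_seqP => n; apply/subsetPset => x /=.
    rewrite /F/= !in_itv/= !andbT; apply: le_trans.
    by rewrite lef_pV2 ?posrE// ler_nat.
  - by move=> i; exact: measurable_itv.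
  - by move=> i; exact: measurable_funTS.
  - by move=> i x _; rewrite lee_fin power_lindley_pdf_ge0.
apply: (cvg_unique _ h1) => //.
rewrite (_ : (fun n : nat => _) = fun n => (- G n.+1%:R^-1)%:E); last first.
  by apply/funext => n; exact: integral_pdf_itv.
apply: cvg_EFin; first exact: nearW.
rewrite -[X in _ --> X]opprK; apply: cvgN.
have /cvg_at_rightP := G_cvg0; apply; split; last exact: cvg_harmonic.
by move=> n; rewrite invr_gt0.
Qed.

End power_lindley_pdf_theory.

(* The positivity proofs do not enter the value: they are arguments so that the
   probability instance below can be inferred. *)
Definition power_lindley (R : realType) (alpha beta : R)
    (alpha_gt0 : 0 < alpha) (beta_gt0 : 0 < beta) :
    set (measurableTypeR R) -> \bar R :=
  fun A => (\int[lebesgue_measure]_(x in A) (power_lindley_pdf alpha beta x)%:E)%E.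
Arguments power_lindley {R} alpha beta alpha_gt0 beta_gt0 _.

Section power_lindley_probability.
Context {R : realType}.
Variables (alpha beta : R) (alpha_gt0 : 0 < alpha) (beta_gt0 : 0 < beta).
Local Notation mu := lebesgue_measure.
Local Notation pdf := (power_lindley_pdf alpha beta).
Local Notation PL := (power_lindley alpha beta alpha_gt0 beta_gt0).

Let pdf_ge0 x : 0 <= pdf x. Proof. exact: power_lindley_pdf_ge0. Qed.

Let power_lindley0 : PL set0 = 0%E.
Proof. by rewrite /power_lindley integral_set0. Qed.

Let power_lindley_ge0 A : (0 <= PL A)%E.
Proof. by apply: integral_ge0 => x _; rewrite lee_fin. Qed.

Let power_lindley_sigma_additive : semi_sigma_additive PL.
Proof.
move=> /= F mF tF mUF; rewrite /power_lindley; apply: cvg_toP.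
  apply: ereal_nondecreasing_is_cvgn => m n mn.
  apply: lee_sum_nneg_natr => // k _ _; apply: integral_ge0 => /= x Fkx.
  by rewrite lee_fin.
rewrite ge0_integral_bigcup//=.
- apply/measurable_funTS/measurableT_comp => //.
  exact: measurable_power_lindley_pdf.
- by move=> x _; rewrite lee_fin.
Qed.

HB.instance Definition _ := isMeasure.Build _ _ _
  PL power_lindley0 power_lindley_ge0 power_lindley_sigma_additive.

Let power_lindley_setT : PL [set: _] = 1%E.
Proof. exact: integral_power_lindley_pdf. Qed.

HB.instance Definition _ :=
  @Measure_isProbability.Build _ _ R PL power_lindley_setT.

End power_lindley_probability.

Definition finite_moments (R : realType)
    (P : probability (measurableTypeR R) R) : Prop :=
  forall n : nat, P.-integrable [set: R] (fun x : R => (x ^+ n)%:E).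

Definition moment (R : realType) (P : probability (measurableTypeR R) R)
    (n : nat) : \bar R :=
  'E_P[(fun x : R => x ^+ n)].

(* Probability measures are compared on measurable sets only: the library
   leaves their values elsewhere unconstrained. *)
Definition moment_determinate (R : realType)
    (P : probability (measurableTypeR R) R) : Prop :=
  finite_moments P /\
  forall Q : probability (measurableTypeR R) R,
    finite_moments Q -> (forall n, moment Q n = moment P n) ->
    forall A : set (measurableTypeR R), measurable A -> Q A = P A.

Definition moment_indeterminate (R : realType)
    (P : probability (measurableTypeR R) R) : Prop :=
  finite_moments P /\ ~ moment_determinate P.

Section power_lindley_moments.
Context {R : realType}.
Variables (alpha beta : R) (alpha_gt0 : 0 < alpha) (beta_gt0 : 0 < beta).
Local Notation mu := (@lebesgue_measure R).
Local Notation pdf := (power_lindley_pdf alpha beta).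
Local Notation PL := (power_lindley alpha beta alpha_gt0 beta_gt0).

Lemma power_lindley_dominates : PL `<< mu.
Proof.
apply/null_content_dominatesP => A mA muA0; apply: null_set_integral => //=.
apply: measurable_funTS; apply/measurable_EFinP.
exact: measurable_power_lindley_pdf.
Qed.

Lemma ge0_integral_power_lindley (f : measurableTypeR R -> \bar R) :
  (forall x, 0 <= f x)%E -> measurable_fun [set: _] f ->
  (\int[PL]_x f x = \int[mu]_x (f x * (pdf x)%:E))%E.
Proof.
move=> f0 mf.
rewrite -(Radon_Nikodym_SigmaFinite.change_of_variables power_lindley_dominates f0 measurableT mf).
have mpdf : measurable_fun [set: R] (EFin \o pdf).
  by apply/measurable_EFinP; exact: measurable_power_lindley_pdf.
have iRN := Radon_Nikodym_SigmaFinite.f_integrable power_lindley_dominates.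
apply: ae_eq_integral => //.
- by apply: emeasurable_funM => //; exact: measurable_int iRN.
- exact: emeasurable_funM.
- apply: ae_eqe_mul2l => /=; apply: integral_ae_eq => //=.
  by move=> E _ mE; rewrite -Radon_Nikodym_SigmaFinite.f_integral//; exact: power_lindley_dominates.
Qed.

End power_lindley_moments.

Lemma power_lindley_pdf_moment_bound (R : realType) (alpha beta : R) (n : nat) :
  0 < alpha -> 0 < beta -> exists2 C : R, 0 <= C &
  forall x, `|x| ^+ n * power_lindley_pdf alpha beta x <=
            C * power_lindley_pdf alpha (beta / 2) x.
Proof.
move=> a0 b0.
have b20 : 0 < beta / 2 by rewrite divr_gt0.
have [m hm] : exists m : nat, n%:R <= alpha * m.+1%:R.
  exists (Num.truncn (n%:R / alpha)).
  by rewrite mulrC -ler_pdivrMr// ltW// truncnS_gt.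
have bnd (x : R) : 0 < x -> x ^+ n * expR (- (beta / 2) * x `^ alpha) <=
    1 + m.+1`!%:R / (beta / 2) ^+ m.+1.
  move=> x0; set u := x `^ alpha; have u0 : 0 <= u by exact: powR_ge0.
  have hx : x ^+ n <= 1 + u ^+ m.+1.
    have um : u ^+ m.+1 = x `^ (alpha * m.+1%:R).
      by rewrite powRrM powR_mulrn.
    have [x1|x1] := leP x 1.
      apply: (@le_trans _ _ 1); last by rewrite lerDl exprn_ge0.
      by apply: exprn_ile1 => //; exact: ltW.
    rewrite (@le_trans _ _ (u ^+ m.+1)) ?lerDr// um -powR_mulrn; last exact: ltW.
    by apply: ler_powR => //; exact: ltW.
  have := @expR_ge1Dxn R (beta / 2 * u) m (mulr_ge0 (ltW b20) u0).
  set E := expR _ => hE.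
  have E0 : 0 < E by exact: expR_gt0.
  rewrite mulNr expRN -/E ler_pdivrMr//.
  have f0 : 0 < m.+1`!%:R :> R by rewrite ltr0n fact_gt0.
  have p0 : 0 < (beta / 2) ^+ m.+1 by rewrite exprn_gt0.
  have E1 : 1 <= E by rewrite (le_trans _ hE)// lerDl divr_ge0 ?exprn_ge0 ?mulr_ge0// ltW.
  have E2 : u ^+ m.+1 <= m.+1`!%:R / (beta / 2) ^+ m.+1 * E.
    rewrite mulrAC ler_pdivlMr// mulrC -exprMn -ler_pdivrMl// mulrC.
    by rewrite (le_trans _ hE)// lerDr.
  by rewrite (le_trans hx)// mulrDl mul1r lerD.
pose K b : R := alpha * b ^+ 2 / (b + 1).
have K0 b : 0 < b -> 0 < K b.
  by move=> ?; rewrite /K divr_gt0 ?mulr_gt0 ?exprn_gt0 ?addr_gt0.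
pose D : R := 1 + m.+1`!%:R / (beta / 2) ^+ m.+1.
have D0 : 0 <= D by rewrite addr_ge0// divr_ge0// exprn_ge0// ltW.
exists (K beta / K (beta / 2) * D).
  by rewrite mulr_ge0// divr_ge0// ltW// K0.
move=> x; rewrite /power_lindley_pdf; case: ifPn => x0; last by rewrite !mulr0.
rewrite gtr0_norm// -/(K beta) -/(K (beta / 2)).
clearbody K.
set u := x `^ alpha.
have -> : expR (- beta * u) = expR (- (beta / 2) * u) * expR (- (beta / 2) * u).
  by rewrite -expRD; congr expR; field.
have -> : x ^+ n * (K beta * (1 + u) * x `^ (alpha - 1) *
    (expR (- (beta / 2) * u) * expR (- (beta / 2) * u))) =
  K beta * (1 + u) * x `^ (alpha - 1) * expR (- (beta / 2) * u) *
    (x ^+ n * expR (- (beta / 2) * u)) by ring.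
have -> : K beta / K (beta / 2) * D *
    (K (beta / 2) * (1 + u) * x `^ (alpha - 1) * expR (- (beta / 2) * u)) =
  K beta * (1 + u) * x `^ (alpha - 1) * expR (- (beta / 2) * u) * D.
  by field; rewrite gt_eqF// K0.
rewrite ler_wpM2l ?bnd//.
by rewrite !mulr_ge0 ?expR_ge0 ?powR_ge0 ?addr_ge0 ?powR_ge0// ltW// K0.
Qed.

Lemma power_lindley_finite_moments (R : realType) (alpha beta : R)
    (alpha_gt0 : 0 < alpha) (beta_gt0 : 0 < beta) :
  finite_moments (power_lindley alpha beta alpha_gt0 beta_gt0).
Proof.
move=> n; have mX : measurable_fun [set: R] (fun x : R => (x ^+ n)%:E).
  by apply/measurable_EFinP; exact: measurable_funX.
apply/integrableP; split => //.
rewrite ge0_integral_power_lindley//; last exact: measurableT_comp.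
have b20 : 0 < beta / 2 by rewrite divr_gt0.
have [C C0 hC] := power_lindley_pdf_moment_bound n alpha_gt0 beta_gt0.
have mp b : measurable_fun [set: R] (EFin \o power_lindley_pdf alpha b).
  by apply/measurable_EFinP; exact: measurable_power_lindley_pdf.
apply: (@le_lt_trans _ _ (\int[lebesgue_measure]_x
    (C%:E * (power_lindley_pdf alpha (beta / 2) x)%:E))%E).
  apply: ge0_le_integral => //=.
  - move=> x _; apply: mule_ge0; rewrite lee_fin ?normr_ge0//.
    exact: power_lindley_pdf_ge0.
  - apply: emeasurable_funM; last exact: mp.
    exact/measurable_EFinP/measurableT_comp/measurable_EFinP.
  - by apply: emeasurable_funM; [exact: measurable_cst|exact: mp].
  - by move=> x _; rewrite -!EFinM lee_fin normrX; exact: hC.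
rewrite ge0_integralZl_EFin//.
- by rewrite integral_power_lindley_pdf// mule1 ltry.
- by move=> x _; rewrite lee_fin power_lindley_pdf_ge0.
- exact: mp.
Qed.

(* Main.v *)
(* Determinacy for alpha >= 1/2.  A probability P on [0, oo) such that
   exp (c * sqrt x) is P-integrable for some c > 0 is determined by its moments
   among all probabilities on the line.  Let Q have the same moments, and let q
   be a polynomial with q >= 1.  If p is a polynomial, the integral of
   (1 - q p)^2 is the same under P and Q, and it controls the distance between
   the integrals of 1/q and of p; so it suffices to make it arbitrarily small
   under P, i.e. to approximate 1/q by polynomials in L^2(q^2 P).  The bounded
   functions f such that every f * polynomial is so approximable form an algebra
   closed under bounded pointwise limits.  It contains cos (h sqrt x) for small h
   (Taylor series), hence (2 / h^2) (1 - cos (h sqrt x)), which tends to x as h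
   tends to 0, hence 1/q.  Thus P and Q give the same integral to 1/q, and
   q = 1 + c ((x - a) / b)^(2n), n -> oo, shows that P and Q agree on intervals.

   Indeterminacy for alpha < 1/2.  All moments of
   x^(alpha-1) exp (- beta x^alpha) sin (w x^alpha - pi alpha), for
   w = beta tan (pi alpha), vanish: up to a factor, the n-th moment is the
   imaginary part of e^(-i s t) * int u^(s-1) e^(-B e^(-i t) u) du with
   u = x^alpha, s = (n + alpha) / alpha, t = pi alpha and B = beta / cos t, and
   by rotation of the contour this quantity does not depend on t in [0, pi / 2).
   The independence is proved by differentiating under the integral sign: the
   t-derivative of the integrand is an exact x-derivative.  Adding a multiple of
   this function to the density gives another probability with the same moments. *)
Require Import Defs.
From HB Require Import structures.
From mathcomp Require Import all_boot all_order all_algebra.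
From mathcomp Require Import ring lra.
From mathcomp Require Import all_classical all_reals all_analysis.
From mathcomp Require Import measurable_realfun.

Set Implicit Arguments.
Unset Strict Implicit.
Unset Printing Implicit Defensive.

Import Order.TTheory GRing.Theory Num.Theory.
Import numFieldNormedType.Exports.

Local Open Scope classical_set_scope.
Local Open Scope ring_scope.

(** * Polynomial approximation in weighted L2 *)

Section polynomial_approximation.
Context {R : realType} (P : probability (measurableTypeR R) R).
Variable w : {poly R}.
Let D : set (measurableTypeR R) := `[0%R, +oo[%classic.
Let mD : measurable D. Proof. exact: measurable_itv. Qed.

(** The squared seminorm of L^2(w^2 P) on the half-line. Keeping it squared and extended-real avoids
    both square roots and integrability conditions on f. *)
Definition wsqnorm (f : R -> R) : \bar R :=
  (\int[P]_(x in `[0%R, +oo[) ((w.[x] * f x) ^+ 2)%:E)%E.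

(** Membership in the closure of the polynomials in L^2(w^2 P). *)
Definition poly_approx (f : R -> R) : Prop :=
  measurable_fun [set: measurableTypeR R] (f : measurableTypeR R -> R) /\
  forall e : R, 0 < e ->
    exists p : {poly R}, (wsqnorm (fun x => f x - p.[x])%R < e%:E)%E.

(** Only products with polynomials are tested. Because f is bounded, it then maps the whole closure
    of the polynomials into itself, which is what makes these functions an algebra. *)
Definition poly_multiplier (f : R -> R) : Prop :=
  [/\ measurable_fun [set: measurableTypeR R] (f : measurableTypeR R -> R),
      exists B : R, forall x, `|f x| <= B &
      forall r : {poly R}, poly_approx (fun x => f x * r.[x])].

Lemma measurable_horner (p : {poly R}) :
  measurable_fun [set: measurableTypeR R] (fun x : measurableTypeR R => p.[x]).
Proof. by apply: continuous_measurable_fun; exact: continuous_horner. Qed.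

Let mh := measurable_horner.

Lemma measurable_wsq (f : R -> R) :
  measurable_fun [set: measurableTypeR R] (f : measurableTypeR R -> R) ->
  measurable_fun D (fun x : measurableTypeR R => ((w.[x] * f x) ^+ 2)%:E).
Proof.
move=> mf; apply: measurable_funTS; apply/measurable_EFinP.
by apply: measurable_funX; apply: measurable_funM.
Qed.

Lemma wsqnorm_le (k : R) (f g : R -> R) : 0 <= k ->
  measurable_fun [set: measurableTypeR R] (f : measurableTypeR R -> R) ->
  measurable_fun [set: measurableTypeR R] (g : measurableTypeR R -> R) ->
  (forall x, `|f x| <= k * `|g x|) ->
  (wsqnorm f <= (k ^+ 2)%:E * wsqnorm g)%E.
Proof.
move=> k0 mf mg fg; rewrite /wsqnorm -ge0_integralZl_EFin//; first last.
- exact: sqr_ge0.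
- exact: measurable_wsq.
- by move=> x _; rewrite lee_fin sqr_ge0.
apply: ge0_le_integral => //.
- by move=> x _; rewrite lee_fin sqr_ge0.
- exact: measurable_wsq.
- apply: emeasurable_funM => //; exact: measurable_wsq.
- move=> x _; rewrite -EFinM lee_fin !exprMn [leRHS]mulrCA ler_wpM2l ?sqr_ge0//.
  rewrite -exprMn -[leLHS]real_normK ?num_real// -[leRHS]real_normK ?num_real//.
  rewrite ler_pXn2r ?nnegrE ?normr_ge0//.
  by rewrite normrM (ger0_norm k0).
Qed.

Lemma le_wsqnorm (f g : R -> R) :
  measurable_fun [set: measurableTypeR R] (f : measurableTypeR R -> R) ->
  measurable_fun [set: measurableTypeR R] (g : measurableTypeR R -> R) ->
  (forall x, `|f x| <= `|g x|) -> (wsqnorm f <= wsqnorm g)%E.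
Proof.
move=> mf mg fg.
have := @wsqnorm_le 1 f g ler01 mf mg; rewrite expr1n mul1e; apply => x.
by rewrite mul1r.
Qed.

(** Substitute for the triangle inequality: (a + b)^2 <= 2 a^2 + 2 b^2, the difference being (a -
    b)^2. *)
Lemma wsqnormD (f g : R -> R) :
  measurable_fun [set: measurableTypeR R] (f : measurableTypeR R -> R) ->
  measurable_fun [set: measurableTypeR R] (g : measurableTypeR R -> R) ->
  (wsqnorm (fun x => f x + g x)%R <= 2%:E * wsqnorm f + 2%:E * wsqnorm g)%E.
Proof.
move=> mf mg; rewrite /wsqnorm -!ge0_integralZl_EFin//;
  try (by move=> x _; rewrite lee_fin sqr_ge0); try exact: measurable_wsq.
rewrite -ge0_integralD//; first last.
- apply: emeasurable_funM => //; exact: measurable_wsq.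
- by move=> x _; rewrite -EFinM lee_fin mulr_ge0 ?sqr_ge0.
- apply: emeasurable_funM => //; exact: measurable_wsq.
- by move=> x _; rewrite -EFinM lee_fin mulr_ge0 ?sqr_ge0.
apply: ge0_le_integral => //.
- by move=> x _; rewrite lee_fin sqr_ge0.
- by apply: (@measurable_wsq (fun x => f x + g x)); exact: measurable_funD.
- by apply: emeasurable_funD; apply: emeasurable_funM => //; exact: measurable_wsq.
- move=> x _; rewrite -!EFinM -EFinD lee_fin.
  have := sqr_ge0 (w.[x] * f x - w.[x] * g x); nra.
Qed.

Lemma eq_wsqnorm (f g : R -> R) : f =1 g -> wsqnorm f = wsqnorm g.
Proof. by move=> /funext ->. Qed.

Lemma poly_approx_poly (p : {poly R}) : poly_approx (fun x => p.[x]).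
Proof.
split; first exact: mh.
move=> e e0; exists p; rewrite /wsqnorm (eq_integral (cst 0%E)) ?integral0 ?lte_fin//.
by move=> x _; rewrite subrr mulr0 expr0n.
Qed.

Lemma poly_approxD (f g : R -> R) : poly_approx f -> poly_approx g ->
  poly_approx (fun x => f x + g x).
Proof.
move=> [mf af] [mg ag]; split; first exact: measurable_funD.
(* [wsqnormD] doubles each of the two errors, hence e / 4. *)
move=> e e0; have [p hp] := af (e / 4) (divr_gt0 e0 (ltr0n _ 4)).
have [q hq] := ag (e / 4) (divr_gt0 e0 (ltr0n _ 4)).
exists (p + q).
rewrite (@eq_wsqnorm _ (fun x => (f x - p.[x]) + (g x - q.[x]))); last first.
  by move=> x; rewrite hornerD opprD addrACA.
apply: le_lt_trans (wsqnormD _ _) _; [exact: measurable_funB|exact: measurable_funB|].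
rewrite (_ : e%:E = (2%:E * (e / 4)%:E + 2%:E * (e / 4)%:E)%E); last first.
  by rewrite -!EFinM -EFinD; congr EFin; field.
by apply: lteD; rewrite lte_pmul2l ?lte_fin.
Qed.

(** Approximate g by a polynomial p, then f p by a polynomial q: f g - q = f (g - p) + (f p - q),
    where the first term is controlled by the bound B of f. *)
Lemma poly_approx_multiplierM (f g : R -> R) :
  poly_multiplier f -> poly_approx g -> poly_approx (fun x => f x * g x).
Proof.
move=> [mf [B fB] af] [mg ag]; split; first exact: measurable_funM.
have B0 : 0 <= B by exact: le_trans (fB 0).
have B10 : 0 < B ^+ 2 + 1 by rewrite ltr_wpDl ?sqr_ge0.
(* The factor lost is B^2; dividing by B^2 + 1 also covers B = 0. *)
move=> e e0; have [p hp] := ag (e / 4 / (B ^+ 2 + 1)) (divr_gt0 (divr_gt0 e0 (ltr0n _ 4)) B10).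
have [_ /(_ (e / 4) (divr_gt0 e0 (ltr0n _ 4)))[q hq]] := af p.
exists q.
rewrite (@eq_wsqnorm _ (fun x => f x * (g x - p.[x]) + (f x * p.[x] - q.[x]))); last first.
  by move=> x; ring.
have mgp : measurable_fun [set: measurableTypeR R] (fun x : measurableTypeR R => g x - p.[x]).
  exact: measurable_funB.
apply: le_lt_trans (wsqnormD _ _) _; [exact: measurable_funM| |].
  by apply: measurable_funB => //; exact: measurable_funM.
rewrite (_ : e%:E = (2%:E * (e / 4)%:E + 2%:E * (e / 4)%:E)%E); last first.
  by rewrite -!EFinM -EFinD; congr EFin; field.
apply: lteD; rewrite lte_pmul2l ?lte_fin//.
apply: (@le_lt_trans _ _ ((B ^+ 2)%:E * wsqnorm (fun x => g x - p.[x])%R)%E).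
  apply: wsqnorm_le => //; first exact: measurable_funM.
  by move=> x; rewrite normrM ler_wpM2r.
apply: (@le_lt_trans _ _ ((B ^+ 2 + 1)%:E * wsqnorm (fun x => g x - p.[x])%R)%E).
  apply: lee_wpmul2r; last by rewrite lee_fin lerDl.
  by apply: integral_ge0 => x _; rewrite lee_fin sqr_ge0.
rewrite (_ : (e / 4)%:E = ((B ^+ 2 + 1)%:E * (e / 4 / (B ^+ 2 + 1))%:E)%E).
  by rewrite lte_pmul2l ?lte_fin.
by rewrite -EFinM mulrCA mulfV ?mulr1// gt_eqF.
Qed.

(** Dominated convergence makes f - f_n small in norm, and f_n is close to a polynomial. Convergence
    and domination are asked on x >= 0 only, where [wsqnorm] integrates. *)
Lemma poly_approx_dominated (f_ : nat -> R -> R) (f g : R -> R) :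
  (forall n, poly_approx (f_ n)) ->
  measurable_fun [set: measurableTypeR R] (f : measurableTypeR R -> R) ->
  measurable_fun [set: measurableTypeR R] (g : measurableTypeR R -> R) ->
  (wsqnorm g < +oo)%E ->
  (forall x : R, 0 <= x -> f_ ^~ x @ \oo --> f x) ->
  (forall n (x : R), 0 <= x -> `|f_ n x| <= g x) -> poly_approx f.
Proof.
move=> af mf mg goo fcvg fg; split => // e e0.
have mf_ n : measurable_fun [set: measurableTypeR R] (f_ n : measurableTypeR R -> R).
  by have [] := af n.
have fg' x : 0 <= x -> `|f x| <= g x.
  move=> x0; have fx : `|f_ n x| @[n --> \oo] --> `|f x|.
    by apply: cvg_norm; exact: fcvg.
  rewrite -(cvg_lim _ fx)//; apply: limr_le; first by apply: cvgP fx.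
  by apply: nearW => n; exact: fg.
(* Both |f| and |f_n| are at most g, so (w (f - f_n))^2 is dominated by 4 (w g)^2. *)
have : wsqnorm (fun x => f x - f_ n x) @[n --> \oo] --> 0%E.
  rewrite -(@integral0 _ _ R P D).
  have [] // := @dominated_convergence _ _ R P D mD
    (fun n x => ((w.[x] * (f x - f_ n x)) ^+ 2)%:E) (cst 0%E)
    (fun x => (4 * (w.[x] * g x) ^+ 2)%:E).
  - by move=> n; apply: (@measurable_wsq (fun x => f x - f_ n x)); exact: measurable_funB.
  - apply/aeW => x; rewrite /D/= in_itv/= andbT => x0.
    apply: cvg_EFin; first exact: nearW.
    rewrite (_ : 0 = (w.[x] * (f x - f x)) ^+ 2); last by rewrite subrr mulr0 expr0n.
    have h : w.[x] * (f x - f_ n x) @[n --> \oo] --> w.[x] * (f x - f x).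
      apply: cvgM; first exact: cvg_cst.
      by apply: cvgB; [exact: cvg_cst|exact: fcvg].
    exact: (cvgM h h).
  - have mg4 : measurable_fun D (fun x : measurableTypeR R => (4 * (w.[x] * g x) ^+ 2)%:E).
      by rewrite (_ : (fun x => _) = (fun x => 4%:E * ((w.[x] * g x) ^+ 2)%:E)%E)//;
        apply: emeasurable_funM => //; exact: measurable_wsq.
    apply/integrableP; split => //.
    rewrite (@eq_integral _ (measurableTypeR R) R P D
      (fun x => 4%:E * ((w.[x] * g x) ^+ 2)%:E)%E); last first.
      by move=> x _; rewrite gee0_abs ?EFinM// lee_fin mulr_ge0 ?sqr_ge0.
    rewrite ge0_integralZl_EFin//; last exact: measurable_wsq.
      by rewrite lte_mul_pinfty// lee_fin.
    by move=> x _; rewrite lee_fin sqr_ge0.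
  - apply/aeW => x n; rewrite /D/= in_itv/= andbT => x0.
    rewrite ger0_norm ?sqr_ge0// lee_fin.
    rewrite (_ : 4 * _ = (w.[x] * (2 * g x)) ^+ 2); last by ring.
    rewrite -[leLHS]real_normK ?num_real// -[leRHS]real_normK ?num_real//.
    rewrite ler_pXn2r ?nnegrE ?normr_ge0// !normrM ler_wpM2l//.
    apply: (le_trans (ler_normB _ _)).
    have := fg n x x0; have := fg' x x0.
    have := ler_norm (g x); have := normr_ge0 (f x).
    rewrite (ger0_norm (_ : 0 <= 2))//; nra.
move=> /fine_cvgP[ffin] /cvgrPdist_lt/(_ (e / 4) (divr_gt0 e0 (ltr0n _ 4))) => hn.
have [n [fin hn4]] : exists n, wsqnorm (fun x => f x - f_ n x) \is a fin_num /\
    (wsqnorm (fun x => f x - f_ n x)%R < (e / 4)%:E)%E.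
  near \oo => n; exists n.
  have fin : wsqnorm (fun x => f x - f_ n x) \is a fin_num by near: n.
  split => //; rewrite -(fineK fin) lte_fin.
  apply: le_lt_trans (ler_norm _) _; rewrite -normrN -[X in `|X|]add0r.
  by near: n.
have [_ /(_ (e / 4) (divr_gt0 e0 (ltr0n _ 4)))[p hp]] := af n.
exists p; rewrite (@eq_wsqnorm _ (fun x => (f x - f_ n x) + (f_ n x - p.[x]))); last first.
  by move=> x; ring.
apply: le_lt_trans (wsqnormD _ _) _; [exact: measurable_funB|exact: measurable_funB|].
rewrite (_ : e%:E = (2%:E * (e / 4)%:E + 2%:E * (e / 4)%:E)%E); last first.
  by rewrite -!EFinM -EFinD; congr EFin; field.
by apply: lteD; rewrite lte_pmul2l ?lte_fin.
Unshelve. all: end_near. Qed.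

End polynomial_approximation.

(** * The algebra of multipliers and its closure properties *)

Section polynomial_multipliers.
Context {R : realType} (P : probability (measurableTypeR R) R).
Variable w : {poly R}.
Local Notation mult := (poly_multiplier P w).
Local Notation approx := (poly_approx P w).

Lemma eq_poly_approx (f g : R -> R) : f =1 g -> approx f -> approx g.
Proof. by move=> /funext ->. Qed.

Lemma eq_poly_multiplier (f g : R -> R) : f =1 g -> mult f -> mult g.
Proof. by move=> /funext ->. Qed.

Lemma poly_multiplier_cst (c : R) : mult (fun=> c).
Proof.
split; [exact: measurable_cst|by exists (`|c|)|move=> r].
apply: (@eq_poly_approx (fun x => (c *: r).[x])); last exact: poly_approx_poly.
by move=> x; rewrite hornerZ.
Qed.

Lemma poly_multiplierD (f g : R -> R) : mult f -> mult g ->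
  mult (fun x => f x + g x).
Proof.
move=> [mf [B fB] af] [mg [C gC] ag]; split; first exact: measurable_funD.
  by exists (B + C) => x; rewrite (le_trans (ler_normD _ _))// lerD.
move=> r; apply: eq_poly_approx (poly_approxD (af r) (ag r)).
by move=> x; rewrite mulrDl.
Qed.

Lemma poly_multiplierM (f g : R -> R) : mult f -> mult g ->
  mult (fun x => f x * g x).
Proof.
move=> hf; have [mf [B fB] af] := hf => -[mg [C gC] ag].
split; first exact: measurable_funM.
  by exists (B * C) => x; rewrite normrM ler_pM.
move=> r; apply: eq_poly_approx (poly_approx_multiplierM hf (ag r)).
by move=> x; rewrite mulrA.
Qed.

Lemma poly_multiplier_horner (q : {poly R}) (f : R -> R) : mult f ->
  mult (fun x => q.[f x]).
Proof.
move=> mf; elim/poly_ind: q => [|q c ihq].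
  by apply: eq_poly_multiplier (poly_multiplier_cst 0) => x; rewrite horner0.
apply: (@eq_poly_multiplier (fun x => q.[f x] * f x + c)).
  by move=> x; rewrite hornerMXaddC.
by apply: poly_multiplierD; [exact: poly_multiplierM|exact: poly_multiplier_cst].
Qed.

Hypothesis w_moments : forall r : {poly R}, (wsqnorm P w (horner r) < +oo)%E.

(** For each polynomial r, the products f_n r are dominated by B |r|, whose norm is finite by
    [w_moments]. *)
Lemma poly_multiplier_bounded_cvg (f_ : nat -> R -> R) (f : R -> R) (B : R) :
  (forall n, mult (f_ n)) ->
  measurable_fun [set: measurableTypeR R] (f : measurableTypeR R -> R) ->
  (forall n x, `|f_ n x| <= B) -> (forall x, `|f x| <= B) ->
  (forall x : R, 0 <= x -> f_ ^~ x @ \oo --> f x) -> mult f.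
Proof.
move=> mf_ mf f_B fB cf; split => //; first by exists B.
have B0 : 0 <= B by exact: le_trans (fB 0).
have mr r : measurable_fun [set: measurableTypeR R] (fun x : measurableTypeR R => B * `|r.[x]|).
  apply: measurable_funM => //; apply: measurableT_comp => //.
  exact: measurable_horner.
move=> r; apply: (@poly_approx_dominated _ _ _ (fun n x => f_ n x * r.[x]) _
  (fun x => B * `|r.[x]|)) => //.
- by move=> n; have [] := mf_ n.
- by apply: measurable_funM => //; exact: measurable_horner.
- apply: (@le_lt_trans _ _ ((B ^+ 2)%:E * wsqnorm P w (horner r))%E).
    apply: wsqnorm_le => //; first exact: measurable_horner.
    by move=> x; rewrite normrM normr_id ger0_norm.
  by rewrite lte_mul_pinfty ?lee_fin ?sqr_ge0.
- by move=> x x0; apply: cvgM; [exact: cf|exact: cvg_cst].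
- by move=> n x x0; rewrite normrM ler_wpM2r.
Qed.

(** Geometric series: with u = 1 - f / B in [0, 1), the polynomials B^-1 (1 + u + ... + u^(n-1)) in
    u equal (1 - u^n) / f. They are bounded by 1 and tend to 1 / f. *)
Lemma poly_multiplierV (f : R -> R) (B : R) : mult f ->
  measurable_fun [set: measurableTypeR R] (fun x : measurableTypeR R => (f x)^-1) ->
  (forall x, 1 <= f x <= B) -> mult (fun x => (f x)^-1).
Proof.
move=> mf mfV fB.
have B1 : 1 <= B by have /andP[] := fB 0; exact: le_trans.
have B0 : 0 < B by exact: lt_le_trans B1.
pose u x := 1 - f x / B.
have u01 x : 0 <= u x < 1.
  have /andP[f1 f2] := fB x; rewrite subr_ge0 ltrBlDr ltrDl divr_gt0 ?andbT//;
    last exact: lt_le_trans f1.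
  by rewrite ler_pdivrMr// mul1r.
have f0 x : 0 < f x by have /andP[f1 f2] := fB x; exact: lt_le_trans f1.
have sumE n x : B^-1 * (\sum_(i < n) 'X^i).[u x] = (f x)^-1 * (1 - u x ^+ n).
  rewrite horner_sum; under eq_bigr do rewrite hornerXn.
  rewrite -opprB subrX1 /u.
  by field; rewrite !gt_eqF.
have mu : mult u.
  apply: (@eq_poly_multiplier (fun x => 1 + - B^-1 * f x)).
    by move=> x; rewrite /u mulNr mulrC.
  apply: poly_multiplierD; first exact: poly_multiplier_cst.
  by apply: poly_multiplierM => //; exact: poly_multiplier_cst.
apply: (@poly_multiplier_bounded_cvg (fun n x => (f x)^-1 * (1 - u x ^+ n)) _ 1) => //.
- move=> n; apply: (eq_poly_multiplier (sumE n)).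
  apply: poly_multiplierM; first exact: poly_multiplier_cst.
  exact: poly_multiplier_horner.
- move=> n x; rewrite normrM mulr_ile1//.
    rewrite ger0_norm ?invr_ge0 ?(ltW (f0 _))// invf_le1//.
    by have /andP[] := fB x.
  have /andP[u0 u1] := u01 x.
  have un0 : 0 <= u x ^+ n by exact: exprn_ge0.
  have un1 : u x ^+ n <= 1 by apply: exprn_ile1 => //; exact: ltW.
  by rewrite ger0_norm ?subr_ge0// lerBlDr lerDl.
- move=> x; rewrite ger0_norm ?invr_ge0 ?(ltW (f0 _))// invf_le1//.
  by have /andP[] := fB x.
- move=> x _; rewrite -[X in _ --> X]mulr1; apply: cvgM; first exact: cvg_cst.
  rewrite -[X in _ --> X]subr0; apply: cvgB; first exact: cvg_cst.
  have /andP[u0 u1] := u01 x.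
  have := @cvg_geometric R 1 (u x); rewrite /geometric ger0_norm// => /(_ u1).
  by under eq_fun do rewrite mul1r.
Qed.

End polynomial_multipliers.

(** * The integrability condition on exp (c sqrt x) *)

(** Induction on r: each factor x costs half of the rate d, since the quadratic term of the
    exponential series gives x <= 2 / (d/2)^2 * exp ((d/2) sqrt x). *)
Lemma poly_le_expR_sqrt (R : realType) (r : {poly R}) (d : R) : 0 < d ->
  exists2 C : R, 0 <= C & forall x : R, 0 <= x -> `|r.[x]| <= C * expR (d * Num.sqrt x).
Proof.
elim/poly_ind: r d => [|r c ih] d d0.
  by exists 0 => // x _; rewrite horner0 normr0 mul0r.
have d20 : 0 < d / 2 by rewrite divr_gt0.
have [C C0 hC] := ih _ d20.
exists (C * (2 / (d / 2) ^+ 2) + `|c|).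
  by rewrite addr_ge0// mulr_ge0// divr_ge0// sqr_ge0.
move=> x x0; rewrite hornerMXaddC mulrDl.
have s0 : 0 <= Num.sqrt x by exact: sqrtr_ge0.
have e1 : 1 <= expR (d * Num.sqrt x) by rewrite -expR0 ler_expR mulr_ge0// ltW.
have xe : x <= 2 / (d / 2) ^+ 2 * expR (d / 2 * Num.sqrt x).
  have := @expR_ge1Dxn R (d / 2 * Num.sqrt x) 1%N (mulr_ge0 (ltW d20) s0).
  rewrite exprMn sqr_sqrtr// (_ : 2`! = 2)%N// => h.
  rewrite mulrAC ler_pdivlMr ?exprn_gt0//; lra.
apply: le_trans (ler_normD _ _) _; apply: lerD; last by rewrite ler_peMr.
rewrite normrM (ger0_norm x0).
apply: le_trans (ler_pM _ x0 (hC x x0) xe) _ => //.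
rewrite mulrACA -expRD -mulrDl.
by rewrite (_ : d / 2 + d / 2 = d)//; field.
Qed.

(** The first n terms of the series of cos (h sqrt x). They are polynomial in x because cosine is
    even. *)
Definition cos_sqrt_taylor (R : realType) (h : R) (n : nat) : {poly R} :=
  \poly_(i < n) ((-1) ^+ i * h ^+ i.*2 / i.*2`!%:R).

Lemma cos_sqrt_taylorE (R : realType) (h x : R) (n : nat) : 0 <= x ->
  (cos_sqrt_taylor h n).[x] = series (cos_coeff' (h * Num.sqrt x)) n.
Proof.
move=> x0; rewrite horner_poly /series/= big_mkord; apply: eq_bigr => i _.
rewrite /cos_coeff' exprMn -[in RHS]mul2n [Num.sqrt x ^+ _]exprM sqr_sqrtr// mul2n.
by rewrite mulrA mulrAC.
Qed.

(** In absolute value, the terms of the cosine series are the even terms of the exponential series.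
    The bound is uniform in n, as domination requires. *)
Lemma cos_sqrt_taylor_le (R : realType) (h x : R) (n : nat) : 0 <= h -> 0 <= x ->
  `|(cos_sqrt_taylor h n).[x]| <= expR (h * Num.sqrt x).
Proof.
move=> h0 x0; set u := h * Num.sqrt x.
have u0 : 0 <= u by rewrite mulr_ge0// sqrtr_ge0.
apply: (@le_trans _ _ (series (exp_coeff u) n.*2)); last first.
  apply: nondecreasing_cvgn_le; last exact: is_cvg_series_exp_coeff.
  apply/nondecreasing_seqP => k; rewrite seriesSr lerDl.
  exact: exp_coeff_ge0.
rewrite cos_sqrt_taylorE// -/u.
elim: n => [|n ih]; first by rewrite /series/= !big_geq// normr0.
rewrite doubleS !seriesSr; apply: le_trans (ler_normD _ _) _.
rewrite -addrA lerD//.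
have -> : `|cos_coeff' u n| = exp_coeff u n.*2.
  rewrite /cos_coeff' exp_coeffE/= !normrM normrX normrN1 expr1n mul1r.
  by rewrite ger0_norm ?exprn_ge0// ger0_norm ?invr_ge0// mulrC.
by rewrite lerDl exp_coeff_ge0.
Qed.

Section hardy.
Context {R : realType} (P : probability (measurableTypeR R) R).
Variables (w : {poly R}) (c : R).
Hypothesis c0 : 0 < c.
Hypothesis Pexp :
  (\int[P]_(x in `[0%R, +oo[) (expR (c * Num.sqrt x))%:E < +oo)%E.
Local Notation mult := (poly_multiplier P w).

Lemma continuous_expR_sqrt (h : R) : continuous (fun x : R => expR (h * Num.sqrt x)).
Proof.
move=> x; apply: continuous_comp; last exact: continuous_expR.
by apply: continuousM; [exact: cst_continuous|exact: sqrt_continuous].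
Qed.

Lemma continuous_cos_sqrt (h : R) : continuous (fun x : R => cos (h * Num.sqrt x)).
Proof.
move=> x; apply: continuous_comp; last exact: continuous_cos.
by apply: continuousM; [exact: cst_continuous|exact: sqrt_continuous].
Qed.

(** Origin of c / 4: the polynomial w r is absorbed by one factor exp ((c/4) sqrt x), and the square
    of the product of two such factors is exp (c sqrt x), integrable by [Pexp]. *)
Lemma hardy_wsqnorm (r : {poly R}) :
  (wsqnorm P w (fun x => r.[x] * expR (c / 4 * Num.sqrt x))%R < +oo)%E.
Proof.
have c40 : 0 < c / 4 by rewrite divr_gt0.
have [C C0 hC] := poly_le_expR_sqrt (w * r) c40.
have mexp h : measurable_fun [set: measurableTypeR R]
    (fun x : measurableTypeR R => expR (h * Num.sqrt x)).
  by apply: continuous_measurable_fun; exact: continuous_expR_sqrt.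
apply: (@le_lt_trans _ _ (\int[P]_(x in `[0%R, +oo[) ((C ^+ 2)%:E * (expR (c * Num.sqrt x))%:E))%E).
  apply: ge0_le_integral => //.
  - by move=> x _; rewrite lee_fin sqr_ge0.
  - apply: measurable_wsq; apply: measurable_funM => //.
    exact: measurable_horner.
  - apply: emeasurable_funM => //; apply: measurable_funTS; exact/measurable_EFinP.
  - move=> x; rewrite /= in_itv/= andbT => x0; rewrite -EFinM lee_fin.
    rewrite mulrA -hornerM exprMn.
    rewrite (_ : expR (c * _) =
      expR (c / 4 * Num.sqrt x) ^+ 2 * expR (c / 4 * Num.sqrt x) ^+ 2); last first.
      by rewrite -!expRM_natl -expRD; congr expR; field.
    rewrite [leRHS]mulrA ler_wpM2r ?sqr_ge0// -exprMn -[leLHS]real_normK ?num_real//.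
    rewrite ler_pXn2r ?nnegrE ?normr_ge0// ?mulr_ge0 ?expR_ge0//.
    exact: hC.
rewrite ge0_integralZl_EFin ?sqr_ge0//.
- by rewrite lte_mul_pinfty// lee_fin sqr_ge0.
- by apply: measurable_funTS; exact/measurable_EFinP.
Qed.

Lemma hardy_wsqnorm_poly (r : {poly R}) : (wsqnorm P w (horner r) < +oo)%E.
Proof.
apply: le_lt_trans (hardy_wsqnorm r).
apply: le_wsqnorm; first exact: measurable_horner.
  apply: measurable_funM; first exact: measurable_horner.
  by apply: continuous_measurable_fun; exact: continuous_expR_sqrt.
move=> x; rewrite normrM ler_peMr// ger0_norm ?expR_ge0//.
by rewrite -expR0 ler_expR mulr_ge0 ?sqrtr_ge0// divr_ge0// ltW.
Qed.

(** The Taylor polynomials times r converge pointwise on x >= 0, dominated by |r| exp ((c/4) sqrt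
    x), which has finite norm by [hardy_wsqnorm]. *)
Lemma poly_multiplier_cos_sqrt (h : R) : 0 <= h <= c / 4 ->
  mult (fun x => cos (h * Num.sqrt x)).
Proof.
move=> /andP[h0 hc].
have mcos : measurable_fun [set: measurableTypeR R]
    (fun x : measurableTypeR R => cos (h * Num.sqrt x)).
  by apply: continuous_measurable_fun; exact: continuous_cos_sqrt.
split => //; first by exists 1 => x; exact: cos_max.
move=> r.
apply: (@poly_approx_dominated _ _ _ (fun n x => (cos_sqrt_taylor h n).[x] * r.[x]) _
  (fun x => `|r.[x] * expR (c / 4 * Num.sqrt x)|)).
- move=> n; apply: eq_poly_approx (poly_approx_poly _ _ (cos_sqrt_taylor h n * r)).
  by move=> x; rewrite hornerM.
- by apply: measurable_funM => //; exact: measurable_horner.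
- apply: measurableT_comp => //; apply: measurable_funM; first exact: measurable_horner.
  by apply: continuous_measurable_fun; exact: continuous_expR_sqrt.
- apply: le_lt_trans (hardy_wsqnorm r).
  have mre : measurable_fun [set: measurableTypeR R]
      (fun x : measurableTypeR R => r.[x] * expR (c / 4 * Num.sqrt x)).
    apply: measurable_funM; first exact: measurable_horner.
    by apply: continuous_measurable_fun; exact: continuous_expR_sqrt.
  apply: le_wsqnorm => //; first exact: measurableT_comp.
  by move=> x; rewrite normr_id.
- move=> x x0; apply: cvgM; last exact: cvg_cst.
  under eq_fun do rewrite cos_sqrt_taylorE//.
  exact: cvg_cos_coeff'.
- move=> n x x0; rewrite !normrM mulrC ler_wpM2l// (le_trans (cos_sqrt_taylor_le n h0 x0))//.
  by rewrite ger0_norm ?expR_ge0// ler_expR ler_wpM2r// sqrtr_ge0.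
Qed.

End hardy.

(** The difference quotient at 0 of t -> sin (t s), taken along the sequence k. *)
Lemma cvg_sin_ratio (R : realType) (s : R) (k : nat -> R) :
  (forall n, k n != 0) -> k @ \oo --> 0 ->
  (k n)^-1 * sin (k n * s) @[n --> \oo] --> s.
Proof.
move=> k0 kcvg.
have ds : is_derive (0 : R) (1 : R) (fun t : R => sin (t * s)) s.
  apply: is_derive_eq; rewrite mul0r cos0 /GRing.scale/=; ring.
have [/cvg_ex[/= l hl] dE] := ds.
have ls : l = s.
  rewrite -dE; apply/esym/cvg_lim => //.
move: hl => /cvgr_dnbhsP/(_ k (conj k0 kcvg)); rewrite ls.
apply: cvg_trans; apply: near_eq_cvg; apply: nearW => n.
by rewrite /= scaler1 addr0 mul0r sin0 subr0.
Qed.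

(** * Inverses of polynomials as multipliers *)

Section hardy_inverse.
Context {R : realType} (P : probability (measurableTypeR R) R).
Variables (w : {poly R}) (c : R).
Hypothesis c0 : 0 < c.
Hypothesis Pexp :
  (\int[P]_(x in `[0%R, +oo[) (expR (c * Num.sqrt x))%:E < +oo)%E.
Local Notation mult := (poly_multiplier P w).

(* Converges to x as h tends to 0, and stays bounded for fixed h. *)
Definition versine_sqrt (h x : R) : R := 2 / h ^+ 2 * (1 - cos (h * Num.sqrt x)).

Lemma continuous_versine_sqrt (h : R) : continuous (versine_sqrt h).
Proof.
move=> x; apply: (@continuousM _ _ (fun=> 2 / h ^+ 2) (fun x => 1 - cos (h * Num.sqrt x)));
  first exact: cst_continuous.
by apply: continuousB; [exact: cst_continuous|exact: continuous_cos_sqrt].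
Qed.

Lemma poly_multiplier_versine_sqrt (h : R) : 0 <= h <= c / 4 ->
  mult (versine_sqrt h).
Proof.
move=> hc; apply: (@eq_poly_multiplier _ _ _
  (fun x => 2 / h ^+ 2 * (1 + -1 * cos (h * Num.sqrt x)))).
  by move=> x; rewrite mulN1r.
apply: poly_multiplierM; first exact: poly_multiplier_cst.
apply: poly_multiplierD; first exact: poly_multiplier_cst.
apply: poly_multiplierM; first exact: poly_multiplier_cst.
exact: (poly_multiplier_cos_sqrt _ c0).
Qed.

(** Half-angle formula: with k = h / 2 and s = sqrt x, [versine_sqrt h x] is (sin (k s) / k)^2,
    which tends to s^2 = x. *)
Lemma cvg_versine_sqrt (h : nat -> R) (x : R) : 0 <= x ->
  (forall n, h n != 0) -> h @ \oo --> 0 ->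
  versine_sqrt (h n) x @[n --> \oo] --> x.
Proof.
move=> x0 h0 hcvg.
have kcvg : h n / 2 @[n --> \oo] --> (0 : R).
  by rewrite -(mul0r 2^-1); apply: cvgM => //; exact: cvg_cst.
have k0 n : h n / 2 != 0 by rewrite mulf_neq0// invr_eq0.
have hs := @cvg_sin_ratio _ (Num.sqrt x) _ k0 kcvg.
have := cvgM hs hs; rewrite -expr2 sqr_sqrtr//.
move=> hx; rewrite (_ : (fun n => versine_sqrt (h n) x) =
  (fun n => (h n / 2)^-1 * sin (h n / 2 * Num.sqrt x) *
            ((h n / 2)^-1 * sin (h n / 2 * Num.sqrt x)))); first exact: hx.
apply/funext => n.
rewrite /versine_sqrt.
rewrite (_ : h n * Num.sqrt x = (h n / 2 * Num.sqrt x) *+ 2); last first.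
  by rewrite -mulr_natl; field.
rewrite cos_mulr2n -[in RHS]expr2 exprMn sin2cos2 -mulr_natl.
by field.
Qed.

(** For fixed h, q composed with [versine_sqrt h] is a multiplier, hence bounded, and is at least 1,
    so its inverse is a multiplier. These inverses are bounded by 1 and tend to 1 / q along h_n =
    (c/4) / (n+1). *)
Lemma poly_multiplier_inv (q : {poly R}) : (forall x, 1 <= q.[x]) ->
  mult (fun x => q.[x]^-1).
Proof.
move=> q1; pose h n : R := c / 4 / n.+1%:R.
have c40 : 0 < c / 4 by rewrite divr_gt0.
have h0 n : 0 < h n by rewrite divr_gt0.
have hc n : 0 <= h n <= c / 4.
  by rewrite (ltW (h0 n))/= ler_pdivrMr// ler_peMr ?ler1n// ltW.
have hcvg : h @ \oo --> (0 : R).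
  by rewrite -(mulr0 (c / 4)); apply: cvgM; [exact: cvg_cst|exact: cvg_harmonic].
have qN0 x : q.[x] != 0 by rewrite gt_eqF// (lt_le_trans _ (q1 x)).
have qV1 x : `|q.[x]^-1| <= 1.
  rewrite ger0_norm ?invr_ge0; last exact: le_trans (q1 x).
  by rewrite invf_le1// (lt_le_trans _ (q1 x)).
have my n := poly_multiplier_horner q (poly_multiplier_versine_sqrt (hc n)).
apply: (@poly_multiplier_bounded_cvg _ _ _ _ (fun n x => q.[versine_sqrt (h n) x]^-1) _ 1) => //.
- exact: (hardy_wsqnorm_poly _ c0).
- move=> n; have [_ [B hB] _] := my n.
  apply: (@poly_multiplierV _ _ _ (hardy_wsqnorm_poly w c0 Pexp) _ B) => //.
    apply: continuous_measurable_fun => x.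
    apply: (@continuousV _ _ (fun y => q.[versine_sqrt (h n) y])) => //.
    by apply: continuous_comp; [exact: continuous_versine_sqrt|exact: continuous_horner].
  by move=> x; rewrite q1 (le_trans (ler_norm _)).
- apply: continuous_measurable_fun => x; apply: (@continuousV _ _ (horner q)) => //.
  exact: continuous_horner.
- move=> x x0; apply: cvgV => //.
  apply: continuous_cvg; first exact: continuous_horner.
  by apply: cvg_versine_sqrt => // n; rewrite gt_eqF.
Qed.

End hardy_inverse.

Lemma hardy_inverse_approx (R : realType) (P : probability (measurableTypeR R) R)
    (c : R) (q : {poly R}) (e : R) : 0 < c ->
  (\int[P]_(x in `[0%R, +oo[) (expR (c * Num.sqrt x))%:E < +oo)%E ->
  (forall x, 1 <= q.[x]) -> 0 < e ->
  exists p : {poly R},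
    (\int[P]_(x in `[0%R, +oo[) ((1 - q.[x] * p.[x]) ^+ 2)%:E < e%:E)%E.
Proof.
(* The weight is q itself, and the multiplier 1 / q is applied to the polynomial 1: q (1/q - p) = 1
   - q p. *)
move=> c0 Pexp q1 e0; have [_ _ /(_ 1) [_ /(_ e e0)[p hp]]] := poly_multiplier_inv q c0 Pexp q1.
exists p; apply: le_lt_trans hp; rewrite le_eqVlt; apply/orP; left; apply/eqP.
apply: eq_integral => x _; rewrite hornerC mulr1 mulrBr mulfV//.
by rewrite gt_eqF// (lt_le_trans _ (q1 x)).
Qed.

(** * Comparison of two probabilities with the same moments *)

Section same_moments.
Context {R : realType}.
Implicit Types P Q : probability (measurableTypeR R) R.
Local Notation T := (measurableTypeR R).

Lemma integrable_horner P (p : {poly R}) : finite_moments P ->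
  P.-integrable [set: T] (fun x : T => p.[x]%:E).
Proof.
move=> fP; rewrite (_ : (fun x : T => _) = (fun x : T =>
    \sum_(i < size p) (p`_i)%:E * (x ^+ i)%:E)%E); last first.
  by apply/funext => x; rewrite horner_coef -sumEFin; apply: eq_bigr => i _.
by apply: integrable_sum => // i _; exact: integrableZl.
Qed.

Lemma eq_integral_horner P Q (p : {poly R}) : finite_moments P -> finite_moments Q ->
  (forall n, moment Q n = moment P n) ->
  (\int[Q]_(x in [set: T]) p.[x]%:E = \int[P]_(x in [set: T]) p.[x]%:E)%E.
Proof.
move=> fP fQ PQ.
have hE M : finite_moments M -> (\int[M]_(x in [set: T]) p.[x]%:E =
    \sum_(i < size p) (p`_i)%:E * moment M i)%E.
  move=> fM; rewrite (_ : (fun x : T => _) = (fun x : T =>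
      \sum_(i < size p) (p`_i)%:E * (x ^+ i)%:E)%E); last first.
    by apply/funext => x; rewrite horner_coef -sumEFin; apply: eq_bigr => i _.
  rewrite integral_sum//; last by move=> i; exact: integrableZl.
  by apply: eq_bigr => i _; rewrite integralZl// /moment unlock.
by rewrite !hE//; apply: eq_bigr => i _; rewrite PQ.
Qed.

Lemma integrable_inv_poly P (q : {poly R}) : (forall x, 1 <= q.[x]) ->
  P.-integrable [set: T] (fun x : T => (q.[x]^-1)%:E).
Proof.
move=> q1; have q0 x : 0 < q.[x] by exact: lt_le_trans (q1 x).
apply: (@le_integrable _ T R P _ _ _ (cst 1%:E)) => //.
- apply/measurable_EFinP; apply: continuous_measurable_fun => x.
  apply: (@continuousV _ _ (horner q)); first by rewrite gt_eqF.
  exact: continuous_horner.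
- move=> x _; rewrite !gee0_abs ?lee_fin ?invr_ge0 ?(ltW (q0 _))//.
  by rewrite invf_le1.
- exact: finite_measure_integrable_cst.
Qed.

(* By AM-GM, |1/q - p| <= |1 - q p| <= (d + (1 - q p)^2 / d) / 2. *)
Lemma inv_poly_dist_le P (q p : {poly R}) (d : R) : finite_moments P ->
  (forall x, 1 <= q.[x]) -> 0 < d ->
  `|\int[P]_(x in [set: T]) q.[x]^-1 - \int[P]_(x in [set: T]) p.[x]| <=
   (d + d^-1 * \int[P]_(x in [set: T]) (1 - q.[x] * p.[x]) ^+ 2) / 2.
Proof.
move=> fP q1 d0.
have q0 x : 0 < q.[x] by exact: lt_le_trans (q1 x).
have iq := integrable_inv_poly P q1.
have ip := integrable_horner p fP.
have uE x : (1 - q.[x] * p.[x]) ^+ 2 = ((1 - q * p) ^+ 2).[x].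
  by rewrite horner_exp !hornerE.
have iu : P.-integrable [set: T] (EFin \o (fun x : T => (1 - q.[x] * p.[x]) ^+ 2)).
  by rewrite /comp; under eq_fun do rewrite uE; exact: integrable_horner.
have iqp : P.-integrable [set: T] (EFin \o (fun x : T => q.[x]^-1 - p.[x])).
  by rewrite /comp; under eq_fun do rewrite EFinB; exact: integrableB.
have idu : P.-integrable [set: T] (EFin \o (fun x : T => d^-1 * (1 - q.[x] * p.[x]) ^+ 2)).
  by rewrite /comp; under eq_fun do rewrite EFinM; exact: integrableZl.
have icst (k : R) : P.-integrable [set: T] (EFin \o (fun=> k)).
  exact: finite_measure_integrable_cst.
rewrite -RintegralB// mulrC.
apply: (le_trans (le_normr_Rintegral measurableT iqp)).
have -> : d + d^-1 * \int[P]_(x in [set: T]) (1 - q.[x] * p.[x]) ^+ 2 =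
    \int[P]_(x in [set: T]) (d + d^-1 * (1 - q.[x] * p.[x]) ^+ 2).
  rewrite RintegralD// Rintegral_cst//= probability_setT mulr1.
  by rewrite RintegralZl.
have idd : P.-integrable [set: T] (EFin \o (fun x : T => d + d^-1 * (1 - q.[x] * p.[x]) ^+ 2)).
  exact: (integrableD measurableT (icst d) idu).
rewrite -RintegralZl//; apply: le_Rintegral => //.
- exact: integrable_norm.
- by rewrite /comp; under eq_fun do rewrite EFinM; exact: integrableZl.
move=> x _; set u := 1 - q.[x] * p.[x].
have -> : q.[x]^-1 - p.[x] = u / q.[x] by rewrite /u mulrBl mul1r mulrAC mulfV ?mul1r// gt_eqF.
apply: (@le_trans _ _ `|u|).
  by rewrite normrM ler_piMr// ger0_norm ?invr_ge0 ?(ltW (q0 _))// invf_le1.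
rewrite mulrC ler_pdivlMr// -real_normK ?num_real//.
have -> : `|u| = d * (d^-1 * `|u|) by rewrite mulVKf// gt_eqF.
set k := d^-1 * `|u|.
have -> : d^-1 * (d * k) ^+ 2 = d * k ^+ 2 by field; rewrite gt_eqF.
have := mulr_ge0 (ltW d0) (sqr_ge0 (1 - k)); nra.
Qed.

Lemma hardy_integral_inv_poly P Q (c : R) (q : {poly R}) :
  0 < c -> P `]-oo, 0%R[%classic = 0%E ->
  (\int[P]_(x in `[0%R, +oo[) (expR (c * Num.sqrt x))%:E < +oo)%E ->
  finite_moments P -> finite_moments Q -> (forall n, moment Q n = moment P n) ->
  (forall x, 1 <= q.[x]) ->
  \int[Q]_(x in [set: T]) q.[x]^-1 = \int[P]_(x in [set: T]) q.[x]^-1.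
Proof.
move=> c0 P0 Pexp fP fQ PQ q1; apply/eqP; rewrite eq_sym -subr_eq0 -normr_le0.
apply/ler_addgt0Pl => e e0; rewrite addr0.
(* With error below (e/2)^2 and d = e/2, the bound (d + error / d) / 2 of [inv_poly_dist_le] is at
   most e/2, once for P and once for Q. *)
have [p hp] := hardy_inverse_approx c0 Pexp q1 (exprn_gt0 2 (divr_gt0 e0 (ltr0n _ 2))).
have uE x : (1 - q.[x] * p.[x]) ^+ 2 = ((1 - q * p) ^+ 2).[x].
  by rewrite horner_exp !hornerE.
have := inv_poly_dist_le p fP q1 (divr_gt0 e0 (ltr0n _ 2)).
have := inv_poly_dist_le p fQ q1 (divr_gt0 e0 (ltr0n _ 2)).
have -> : \int[Q]_(x in [set: T]) p.[x] = \int[P]_(x in [set: T]) p.[x].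
  by rewrite /Rintegral (eq_integral_horner p fP fQ).
have -> : \int[Q]_(x in [set: T]) (1 - q.[x] * p.[x]) ^+ 2 =
    \int[P]_(x in [set: T]) (1 - q.[x] * p.[x]) ^+ 2.
  rewrite /Rintegral; under eq_integral do rewrite uE.
  by under [in RHS]eq_integral do rewrite uE; rewrite (eq_integral_horner _ fP fQ).
have : \int[P]_(x in [set: T]) (1 - q.[x] * p.[x]) ^+ 2 < (e / 2) ^+ 2.
  have iu : P.-integrable [set: T] (fun x : T => ((1 - q.[x] * p.[x]) ^+ 2)%:E).
    by under eq_fun do rewrite uE; exact: integrable_horner.
  rewrite -lte_fin /Rintegral fineK; last exact: integrable_fin_num.
  (* The approximation holds on the half-line. As P does not charge the negative axis, it holds on
     the whole line, where equality of moments carries it over to Q. *)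
  rewrite (@negligible_integral _ T R P _ `]-oo, 0[%classic)//.
  by rewrite setTD setCitvl.
set m := \int[P]_(x in [set: T]) _ => mlt.
have : (e / 2)^-1 * m <= e / 2.
  by rewrite ler_pdivrMl ?divr_gt0// -expr2 ltW.
set x1 := Rintegral _ _ _; set x2 := Rintegral _ _ _; set x3 := Rintegral _ _ _.
move=> h h1 h2.
have -> : x3 - x1 = (x3 - x2) - (x1 - x2) by ring.
apply: le_trans (ler_normB _ _) _; lra.
Qed.

End same_moments.

(** * From inverses of polynomials to intervals *)

Lemma cvg_inv_oneD_exp (R : realType) (c z : R) : 0 < c -> 0 <= z ->
  (1 + c * z ^+ n)^-1 @[n --> \oo] -->
  (1 - (1 + c)^-1) * (z < 1)%R%:R + (1 + c)^-1 * (z <= 1)%R%:R.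
Proof.
(* The limit is 1, 0 or 1 / (1 + c) as z is below, above or equal to 1. *)
move=> c0 z0; have [z1|z1|->] := ltgtP z 1.
- rewrite !mulr1 subrK -[X in _ --> X]invr1; apply: cvgV; first exact: oner_neq0.
  rewrite -[X in _ --> X]addr0; apply: cvgD; first exact: cvg_cst.
  rewrite -(mulr0 c); apply: cvgM; first exact: cvg_cst.
  have := @cvg_geometric R 1 z; rewrite /geometric/= ger0_norm// => /(_ z1).
  by under eq_fun do rewrite mul1r.
- rewrite !mulr0 addr0.
  have zp : 0 < z by exact: lt_trans z1.
  have h : c^-1 * z^-1 ^+ n @[n --> \oo] --> (0 : R).
    have := @cvg_geometric R c^-1 z^-1; rewrite /geometric/=; apply.
    by rewrite ger0_norm ?invr_ge0// invf_lt1.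
  apply: (squeeze_cvgr _ (cvg_cst 0) h).
  apply: nearW => n; have zn0 : 0 < z ^+ n by exact: exprn_gt0.
  rewrite /= invr_ge0 addr_ge0 ?mulr_ge0 ?(ltW c0) ?(ltW zn0)//=.
  rewrite exprVn -invfM lef_pV2 ?posrE ?addr_gt0 ?mulr_gt0//.
  by rewrite lerDr.
- rewrite mulr0 add0r mulr1; under eq_fun do rewrite expr1n mulr1.
  exact: cvg_cst.
Qed.

(** For b, c > 0 its inverse tends to the indicator of |x - a| < b, except for the value 1 / (1 + c)
    at the two endpoints. *)
Definition interval_poly (R : realType) (a b c : R) (n : nat) : {poly R} :=
  1 + c *: ((b ^- 2 *: ('X - a%:P) ^+ 2) ^+ n).

Lemma interval_polyE (R : realType) (a b c x : R) (n : nat) :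
  (interval_poly a b c n).[x] = 1 + c * (((x - a) / b) ^+ 2) ^+ n.
Proof.
rewrite /interval_poly !(hornerE, horner_exp); congr (1 + c * _ ^+ n).
by rewrite exprMn exprVn mulrC [in RHS]expr2 mulrA.
Qed.

Lemma interval_poly_ge1 (R : realType) (a b c x : R) (n : nat) : 0 < c ->
  1 <= (interval_poly a b c n).[x].
Proof.
move=> c0; rewrite interval_polyE lerDl; apply: mulr_ge0; first exact: ltW.
by apply: exprn_ge0; exact: sqr_ge0.
Qed.

Section hardy_determinate.
Context {R : realType}.
Implicit Types P Q : probability (measurableTypeR R) R.
Local Notation T := (measurableTypeR R).

Lemma cvg_integral_interval_poly P (a b c : R) : 0 < b -> 0 < c ->
  (\int[P]_(x in [set: T]) ((interval_poly a b c n).[x]^-1)%:E)%E @[n --> \oo] -->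
  ((1 - (1 + c)^-1)%:E * P `](a - b)%R, (a + b)%R[%classic +
    ((1 + c)^-1)%:E * P `[(a - b)%R, (a + b)%R]%classic)%E.
Proof.
move=> b0 c0; set k := (1 + c)^-1.
pose I : set T := `]a - b, a + b[%classic.
pose J : set T := `[a - b, a + b]%classic.
have mI : measurable I by exact: measurable_itv.
have mJ : measurable J by exact: measurable_itv.
have q1 n x : 1 <= (interval_poly a b c n).[x] by exact: interval_poly_ge1.
have <- : (\int[P]_(x in [set: T]) ((1 - k)%:E * (\1_I x)%:E + k%:E * (\1_J x)%:E) =
    (1 - k)%:E * P I + k%:E * P J)%E.
  have iI := integrable_indic P mI; have iJ := integrable_indic P mJ.
  rewrite integralD//; try exact: integrableZl.
  by rewrite !integralZl// !integral_indic// !setIT.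
have [] // := @dominated_convergence _ T R P setT measurableT
  (fun n x => ((interval_poly a b c n).[x]^-1)%:E)
  (fun x => (1 - k)%:E * (\1_I x)%:E + k%:E * (\1_J x)%:E)%E (cst 1%:E).
- by move=> n; have /integrableP[] := integrable_inv_poly P (q1 n).
- apply: emeasurable_funD; apply: emeasurable_funM => //;
    by apply/measurable_EFinP; exact: measurable_indic.
- apply/aeW => x _; rewrite -!EFinM -EFinD.
  apply: cvg_EFin; first exact: nearW.
  under eq_fun do rewrite /= interval_polyE.
  have z0 : 0 <= ((x - a) / b) ^+ 2 by exact: sqr_ge0.
  have := cvg_inv_oneD_exp c0 z0.
  have zE : (`|x - a| < b) = (((x - a) / b) ^+ 2 < 1).
    rewrite exprMn exprVn ltr_pdivrMr ?exprn_gt0// mul1r -real_normK ?num_real//.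
    by rewrite ltr_pXn2r ?nnegrE// ltW.
  have zE' : (`|x - a| <= b) = (((x - a) / b) ^+ 2 <= 1).
    rewrite exprMn exprVn ler_pdivrMr ?exprn_gt0// mul1r -real_normK ?num_real//.
    by rewrite ler_pXn2r ?nnegrE// ltW.
  rewrite -zE -zE' -/k !indicE.
  rewrite (_ : (x \in I) = (`|x - a| < b)); last first.
    by rewrite /I mem_setE in_itv/= ltr_distl.
  by rewrite (_ : (x \in J) = (`|x - a| <= b))// /J mem_setE in_itv/= ler_distl.
- exact: finite_measure_integrable_cst.
- apply/aeW => x n _; rewrite /= lee_fin ger0_norm ?invr_ge0; last exact: le_trans (q1 n x).
  by rewrite invf_le1// (lt_le_trans _ (q1 n x)).
Qed.

Lemma hardy_eq_itvoo P Q (c a b : R) :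
  0 < c -> P `]-oo, 0%R[%classic = 0%E ->
  (\int[P]_(x in `[0%R, +oo[) (expR (c * Num.sqrt x))%:E < +oo)%E ->
  finite_moments P -> finite_moments Q -> (forall n, moment Q n = moment P n) ->
  Q `]a, b[%classic = P `]a, b[%classic.
Proof.
move=> c0 P0 Pexp fP fQ PQ; have [ab|ab] := ltP a b; last first.
  by rewrite set_itv_ge ?measure0// bnd_simp -leNgt.
pose m := (a + b) / 2; pose r := (b - a) / 2.
have r0 : 0 < r by rewrite divr_gt0// subr_gt0.
have am : a = m - r by rewrite /m /r; field.
have bm : b = m + r by rewrite /m /r; field.
rewrite am bm.
have eqk (k : R) : 0 < k -> ((1 - (1 + k)^-1)%:E * Q `](m - r)%R, (m + r)%R[%classic +
      ((1 + k)^-1)%:E * Q `[(m - r)%R, (m + r)%R]%classic =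
    (1 - (1 + k)^-1)%:E * P `](m - r)%R, (m + r)%R[%classic +
      ((1 + k)^-1)%:E * P `[(m - r)%R, (m + r)%R]%classic)%E.
  move=> k0.
  have hQ := @cvg_integral_interval_poly Q m r k r0 k0.
  have hP := @cvg_integral_interval_poly P m r k r0 k0.
  suff QPn : (fun n => \int[Q]_(x in [set: T]) ((interval_poly m r k n).[x]^-1)%:E)%E =
    (fun n => \int[P]_(x in [set: T]) ((interval_poly m r k n).[x]^-1)%:E)%E.
    by rewrite QPn in hQ; exact: (cvg_unique _ hQ hP).
  apply/funext => n.
  have q1 x : 1 <= (interval_poly m r k n).[x] by exact: interval_poly_ge1.
  have iQ := integrable_fin_num measurableT (integrable_inv_poly Q q1).
  have iP := integrable_fin_num measurableT (integrable_inv_poly P q1).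
  rewrite -[LHS](fineK iQ) -[RHS](fineK iP); congr EFin.
  exact: hardy_integral_inv_poly c0 P0 Pexp fP fQ PQ q1.
(* Each k gives one linear relation between the masses of the open and the closed interval. The
   weights 1/2 and 1/4 from k = 1 and k = 3 make the two relations independent, which separates the
   endpoints from the interior. *)
have := eqk 1 ltr01; have := eqk 3 (ltr0n _ 3).
have fin (M : probability T R) (I : interval R) : exists s : R, M [set` I] = s%:E.
  exists (fine (M [set` I])); rewrite fineK//; apply: fin_num_measure.
  exact: measurable_itv.
have [q1 ->] := fin Q `]m - r, m + r[; have [q2 ->] := fin Q `[m - r, m + r].
have [p1 ->] := fin P `]m - r, m + r[; have [p2 ->] := fin P `[m - r, m + r].
rewrite -!EFinM -!EFinD => -[h3] [h1]; congr EFin.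
have e3 : (1 + 3 : R)^-1 = 1 / 4 by field.
have e1 : (1 + 1 : R)^-1 = 1 / 2 by field.
move: h3 h1; rewrite e3 e1; lra.
Qed.

Lemma hardy_moment_determinate P (c : R) :
  0 < c -> P `]-oo, 0%R[%classic = 0%E ->
  (\int[P]_(x in `[0%R, +oo[) (expR (c * Num.sqrt x))%:E < +oo)%E ->
  finite_moments P -> moment_determinate P.
Proof.
move=> c0 P0 Pexp fP; split => // Q fQ PQ A mA.
(* Bounded open intervals are stable under intersection and generate the Borel sets. *)
apply: (@measure_unique _ R T (@RGenOpens.G R) (fun n => `]- n%:R, n%:R[%classic)) => //.
- exact: RGenOpens.measurableE.
- move=> _ _ [a [b ->]] [a' [b' ->]].
  exists (Num.max a a'), (Num.min b b'); apply/seteqP; split => x /=;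
    rewrite !in_itv/= gt_max lt_min; last by case/andP => /andP[-> ->] /andP[-> ->].
  by move=> [/andP[-> ->] /andP[-> ->]].
- by move=> n; exists (- n%:R), n%:R.
- apply/seteqP; split => // x _; exists (Num.truncn `|x|).+1 => //=.
  by rewrite in_itv/= -ltr_norml truncnS_gt.
- by move=> _ [a [b ->]]; exact: (hardy_eq_itvoo _ _ c0 P0 Pexp).
- by move=> n; rewrite (le_lt_trans (probability_le1 _ _))// ?ltry//.
Qed.

End hardy_determinate.

(** * The case alpha >= 1/2 *)

Section power_lindley_hardy.
Context {R : realType}.
Variables (alpha beta : R) (alpha_gt0 : 0 < alpha) (beta_gt0 : 0 < beta).
Local Notation PL := (power_lindley alpha beta alpha_gt0 beta_gt0).
Local Notation T := (measurableTypeR R).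

Lemma power_lindley_neg : PL `]-oo, 0%R[%classic = 0%E.
Proof.
rewrite /power_lindley; apply: integral0_eq => x; rewrite /= in_itv/= => x0.
by rewrite /power_lindley_pdf ltNge (ltW x0).
Qed.

(** The threshold 1/2 enters here: beyond 1, sqrt x is at most x^alpha; up to 1, it is at most 1. *)
Lemma sqrt_le1D_powR (x : R) : 1 / 2 <= alpha -> 0 <= x ->
  Num.sqrt x <= 1 + x `^ alpha.
Proof.
move=> a12 x0; have [x1|x1] := leP x 1.
  rewrite (@le_trans _ _ 1)// ?lerDl ?powR_ge0//.
  by rewrite -[leRHS]sqrtr1 ler_wsqrtr.
rewrite -powR12_sqrt// (@le_trans _ _ (x `^ alpha))// ?lerDr//.
by apply: ler_powR; [exact: ltW|rewrite -div1r].
Qed.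

(** By [sqrt_le1D_powR], exp ((beta/2) sqrt x) uses up at most half of the decay exp (- beta
    x^alpha), up to the factor exp (beta/2). What remains is a multiple of the density with
    parameter beta/2. *)
Lemma power_lindley_expR_sqrt : 1 / 2 <= alpha ->
  (\int[PL]_(x in `[0%R, +oo[) (expR (beta / 2 * Num.sqrt x))%:E < +oo)%E.
Proof.
move=> a12.
have mexp : measurable_fun [set: T] (fun x : T => (expR (beta / 2 * Num.sqrt x))%:E).
  apply/measurable_EFinP; apply: continuous_measurable_fun.
  exact: continuous_expR_sqrt.
apply: (@le_lt_trans _ _ (\int[PL]_x (expR (beta / 2 * Num.sqrt x))%:E)%E).
  apply: ge0_subset_integral => //.
rewrite ge0_integral_power_lindley//.
have b20 : 0 < beta / 2 by rewrite divr_gt0.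
pose K b : R := alpha * b ^+ 2 / (b + 1).
have K0 b : 0 < b -> 0 < K b.
  by move=> ?; rewrite /K divr_gt0 ?mulr_gt0 ?exprn_gt0 ?addr_gt0.
pose C := expR (beta / 2) * (K beta / K (beta / 2)).
have C0 : 0 <= C by rewrite mulr_ge0 ?expR_ge0// divr_ge0// ltW// K0.
have mp b : measurable_fun [set: T] (EFin \o power_lindley_pdf alpha b).
  by apply/measurable_EFinP; exact: measurable_power_lindley_pdf.
apply: (@le_lt_trans _ _ (\int[lebesgue_measure]_(x in [set: T])
    (C%:E * (power_lindley_pdf alpha (beta / 2) x)%:E))%E).
  apply: ge0_le_integral => //=.
  - by move=> x _; rewrite mule_ge0// lee_fin ?expR_ge0 ?power_lindley_pdf_ge0.
  - by apply: emeasurable_funM => //; exact: mp.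
  - by apply: emeasurable_funM; [exact: measurable_cst|exact: mp].
  move=> x _; rewrite -!EFinM lee_fin /power_lindley_pdf.
  case: ifPn => x0; last by rewrite !mulr0.
  rewrite -/(K beta) -/(K (beta / 2)) /C.
  have := K0 _ b20; have := K0 _ beta_gt0; clearbody K => Kb Kb2.
  set u := x `^ alpha; have u0 : 0 <= u by exact: powR_ge0.
  have -> : expR (beta / 2) * (K beta / K (beta / 2)) *
     (K (beta / 2) * (1 + u) * x `^ (alpha - 1) * expR (- (beta / 2) * u)) =
     K beta * (1 + u) * x `^ (alpha - 1) * (expR (beta / 2) * expR (- (beta / 2) * u)).
    by field; rewrite gt_eqF.
  rewrite mulrCA ler_wpM2l//.
    by rewrite !mulr_ge0 ?powR_ge0 ?addr_ge0// ltW.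
  rewrite -!expRD ler_expR.
  have := sqrt_le1D_powR a12 (ltW x0); rewrite -/u; nra.
rewrite ge0_integralZl_EFin//.
- by rewrite integral_power_lindley_pdf// mule1 ltry.
- by move=> x _; rewrite lee_fin power_lindley_pdf_ge0.
- exact: mp.
Qed.

Lemma power_lindley_moment_determinate : 1 / 2 <= alpha -> moment_determinate PL.
Proof.
move=> a12; apply: (@hardy_moment_determinate _ _ (beta / 2)).
- by rewrite divr_gt0.
- exact: power_lindley_neg.
- exact: power_lindley_expR_sqrt.
- exact: power_lindley_finite_moments.
Qed.

End power_lindley_hardy.

(** * Vanishing oscillating integrals *)

(** Apply the fundamental theorem of calculus on [1/(n+2), n+2] and let n tend to infinity, with |f|
    dominating. The shift by 2 keeps these intervals nondegenerate. *)
Lemma integral0y_derive_eq0 (R : realType) (f F : R -> R) :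
  (forall x : R, 0 < x -> is_derive x (1 : R) F (f x)) ->
  (forall x : R, 0 < x -> {for x, continuous f}) ->
  lebesgue_measure.-integrable `]0%R, +oo[%classic (EFin \o f) ->
  F n.+2%:R^-1 @[n --> \oo] --> (0 : R) -> F n.+2%:R @[n --> \oo] --> (0 : R) ->
  \int[lebesgue_measure]_(x in `]0%R, +oo[) f x = 0.
Proof.
move=> dF cf intf F0 Fy.
pose mu : measure (measurableTypeR R) R := lebesgue_measure.
pose D : set (measurableTypeR R) := `]0%R, +oo[%classic.
pose A n : set (measurableTypeR R) := `[n.+2%:R^-1, n.+2%:R]%classic.
have mD : measurable D by exact: measurable_itv.
have mA n : measurable (A n) by exact: measurable_itv.
have n0 n : 0 < n.+2%:R^-1 :> R by rewrite invr_gt0.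
have AD n : A n `<=` D.
  by move=> x; rewrite /A /D/= !in_itv/= andbT => /andP[h _]; exact: lt_le_trans h.
have FTC n : (\int[mu]_(x in A n) (f x)%:E = (F n.+2%:R - F n.+2%:R^-1)%:E)%E.
  have cF x : 0 < x -> {for x, continuous F}.
    by move=> x0; have := dF x x0 => dFx; apply: differentiable_continuous; apply/derivable1_diffP.
  rewrite (@continuous_FTC2 _ f F) ?EFinB//.
  - rewrite (@lt_trans _ _ 1)//; first by rewrite invf_lt1// ltr1n.
    by rewrite ltr1n.
  - apply: continuous_in_subspaceT => x; rewrite inE/= in_itv/= => /andP[h _].
    by apply: cf; exact: lt_le_trans h.
  - split.
    + move=> x; rewrite in_itv/= => /andP[h _].
      by have [] := dF x (lt_trans (n0 n) h).
    + by apply: cvg_at_right_filter; exact: cF.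
    + by apply: cvg_at_left_filter; exact: cF.
  - move=> x; rewrite in_itv/= => /andP[h _].
    by have := dF x (lt_trans (n0 n) h) => dFx; rewrite derive1E derive_val.
have if_abs : mu.-integrable D (abse \o (EFin \o f)) by exact: integrable_abse.
have mf : measurable_fun D (EFin \o f) by case/integrableP : intf.
have [|||||_ _ hcvg] := @dominated_convergence _ _ R mu D mD (fun n => (EFin \o f) \_ (A n))
  (EFin \o f) (abse \o (EFin \o f)).
- move=> n; apply: measurable_funTS; apply/(measurable_restrictT _ (mA n)).
  exact: measurable_funS mD (@AD n) mf.
- exact: mf.
- apply/aeW => x Dx; apply: cvg_near_cst.
  have x0 : 0 < x by move: Dx; rewrite /D/= in_itv/= andbT.
  near=> n; rewrite patchE ifT// inE /A/= in_itv/=; apply/andP; split.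
    have h : x^-1 <= n.+2%:R.
      by rewrite -[n.+2]addn2 natrD ler_wpDr//; near: n; exact: nbhs_infty_ger.
    by rewrite -[leRHS]invrK lef_pV2 ?posrE ?invr_gt0.
  by rewrite -[n.+2]addn2 natrD ler_wpDr//; near: n; exact: nbhs_infty_ger.
- exact: if_abs.
- apply/aeW => x n Dx; rewrite patchE; case: ifPn => //= _.
  by rewrite normr0 lee_fin.
have E : (fun n => \int[mu]_(x in D) ((EFin \o f) \_ (A n)) x)%E =
    (fun n => (F n.+2%:R - F n.+2%:R^-1)%:E).
  apply/funext => n; rewrite -FTC -integral_mkcondr.
  by rewrite setIidr//; exact: AD.
move: hcvg; rewrite E => hcvg.
have h0 : (F n.+2%:R - F n.+2%:R^-1)%:E @[n --> \oo] --> (0 : R)%:E.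
  apply: cvg_EFin; first exact: nearW.
  by rewrite -(subr0 (0 : R)); exact: cvgB.
by have := cvg_unique _ hcvg h0; rewrite /Rintegral => ->.
Unshelve. all: end_near. Qed.

(** On x > 0, x^n times the density of PL(alpha, k) without its normalizing constant; it serves as
    the common dominating function below. *)
Definition lindley_weight (R : realType) (alpha k : R) (n : nat) (x : R) : R :=
  x ^+ n * ((1 + x `^ alpha) * x `^ (alpha - 1) * expR (- k * x `^ alpha)).

Section sector.
Context {R : realType}.
Variables (alpha : R) (alpha_gt0 : 0 < alpha).
Local Notation mu := (@lebesgue_measure R).
Local Notation T := (measurableTypeR R).
Local Notation D := (`]0%R, +oo[%classic : set T).

Lemma integrable_exprn_power_lindley_pdf (beta : R) (n : nat) : 0 < beta ->
  mu.-integrable [set: T] (fun x : T => (x ^+ n * power_lindley_pdf alpha beta x)%:E).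
Proof.
move=> b0; have [C C0 hC] := power_lindley_pdf_moment_bound n alpha_gt0 b0.
have b20 : 0 < beta / 2 by rewrite divr_gt0.
have mp b : measurable_fun [set: T] (power_lindley_pdf alpha b : T -> R).
  exact: measurable_power_lindley_pdf.
apply: (@le_integrable _ T R mu _ _ _
  (fun x => (C * power_lindley_pdf alpha (beta / 2) x)%:E)) => //.
- apply/measurable_EFinP; apply: measurable_funM => //; exact: measurable_funX.
- move=> x _; rewrite lee_fin normrM normrX (ger0_norm (power_lindley_pdf_ge0 _ _ _))//.
  exact: le_trans (hC x) (ler_norm _).
- under eq_fun do rewrite EFinM; apply: integrableZl => //.
  apply/integrableP; split; first exact/measurable_EFinP.
  under eq_integral do rewrite gee0_abs ?lee_fin ?power_lindley_pdf_ge0//.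
  by rewrite integral_power_lindley_pdf// ltry.
Qed.

Lemma integrable_lindley_weight (k : R) (n : nat) : 0 < k ->
  mu.-integrable D (EFin \o lindley_weight alpha k n).
Proof.
move=> k0; pose K := alpha * k ^+ 2 / (k + 1).
have K0 : 0 < K by rewrite divr_gt0 ?mulr_gt0 ?exprn_gt0 ?addr_gt0.
have mD : measurable D by exact: measurable_itv.
have := @integrableS _ T R mu _ D _ measurableT mD (@subsetT _ _)
  (integrable_exprn_power_lindley_pdf n k0).
move=> /(integrableZl mD K^-1); apply: eq_integrable => // x.
rewrite inE/= in_itv/= andbT => x0; rewrite /lindley_weight /power_lindley_pdf x0 -/K.
by rewrite -EFinM; congr EFin; field; rewrite gt_eqF.
Qed.

Lemma integrable_lindley_dominated (f : R -> R) (k C : R) (n : nat) : 0 < k -> 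
  measurable_fun D (f : T -> R) ->
  (forall x : R, 0 < x -> `|f x| <= C * lindley_weight alpha k n x) ->
  mu.-integrable D (EFin \o f).
Proof.
move=> k0 mf hf; have mD : measurable D by exact: measurable_itv.
have := integrableZl mD C (integrable_lindley_weight n k0).
apply: le_integrable => //; first exact/measurable_EFinP.
move=> x; rewrite /= in_itv/= andbT => x0.
by rewrite lee_fin (le_trans (hf x x0))// ler_norm.
Qed.

(* With u = x^alpha, s = (n + alpha) / alpha and z = B e^(-i t): sector_fun and
   sector_prim are the imaginary part of x^(n + alpha - 1) e^(- z u - i s t) and
   the real part of x^(n + alpha) e^(- z u - i s t); sector_dfun is the
   t-derivative of sector_fun. *)
Definition sector_arg (B : R) (n : nat) (t x : R) : R :=
  B * sin t * x `^ alpha - (n%:R + alpha) / alpha * t.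

Definition sector_fun (B : R) (n : nat) (t x : R) : R :=
  x ^+ n * x `^ (alpha - 1) *
  (expR (- (B * cos t) * x `^ alpha) * sin (sector_arg B n t x)).

Definition sector_dfun (B : R) (n : nat) (t x : R) : R :=
  x ^+ n * x `^ (alpha - 1) * (expR (- (B * cos t) * x `^ alpha) *
   (B * x `^ alpha * sin t * sin (sector_arg B n t x) +
    (B * x `^ alpha * cos t - (n%:R + alpha) / alpha) * cos (sector_arg B n t x))).

Definition sector_prim (B : R) (n : nat) (t x : R) : R :=
  x ^+ n * x `^ alpha *
  (expR (- (B * cos t) * x `^ alpha) * cos (sector_arg B n t x)).

Lemma is_derive_sector_fun (B : R) (n : nat) (t x : R) :
  is_derive t (1 : R) (fun t => sector_fun B n t x) (sector_dfun B n t x).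
Proof.
rewrite /sector_fun /sector_dfun /sector_arg.
set u := x `^ alpha; set v := x `^ (alpha - 1); set s := _ / alpha.
by apply: is_derive_eq; rewrite /GRing.scale/=; ring.
Qed.

(** Put E = x^(n + alpha - 1) e^(- z u - i s t). Since dz/dt = - i z, the t-derivative of E is - i
    (s - z u) E, while the x-derivative of x E is alpha (s - z u) E. The claim is the real part of
    d(x E)/dx = i alpha dE/dt. *)
Lemma is_derive_sector_prim (B : R) (n : nat) (t x : R) : 0 < x ->
  is_derive x (1 : R) (sector_prim B n t) (- alpha * sector_dfun B n t x).
Proof.
move=> x0.
have dp : is_derive x (1 : R) (fun y : R => y `^ alpha) (alpha * x `^ (alpha - 1)).
  have xi : x \in `]0, +oo[ by rewrite in_itv/= x0.
  apply: DeriveDef; first exact: derivable_powR.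
  by rewrite -derive1E powR_derive1.
have dX : is_derive x (1 : R) (fun y : R => y ^+ n) (n%:R * x ^+ n.-1).
  apply: DeriveDef; first exact: exprn_derivable.
  by rewrite exp_derive /GRing.scale/= mulr1.
rewrite /sector_prim /sector_dfun /sector_arg.
apply: is_derive_eq.
have xa : x `^ alpha = x * x `^ (alpha - 1).
  have := @powRD R x 1 (alpha - 1); rewrite addrC subrK (gt_eqF x0) implybT => ->//.
  by rewrite powRr1 ?(ltW x0).
rewrite /GRing.scale/= xa; set v := x `^ (alpha - 1).
(* The derivative of [y ^+ n] involves [n.-1], which is truncated at n = 0. *)
case: n {dX} => [|n]; rewrite ?expr0 ?exprS/=; [field|idtac]; rewrite ?gt_eqF//.
by field; rewrite gt_eqF.
Qed.

End sector.

Section sector_integral.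
Context {R : realType}.
Variables (alpha : R) (alpha_gt0 : 0 < alpha).
Local Notation mu := (@lebesgue_measure R).
Local Notation T := (measurableTypeR R).
Local Notation D := (`]0%R, +oo[%classic : set T).

Lemma continuous_powR_gt0 (p x : R) : 0 < x -> {for x, continuous (fun y : R => y `^ p)}.
Proof.
move=> x0; apply: differentiable_continuous; apply/derivable1_diffP.
by apply: derivable_powR; rewrite in_itv/= x0.
Qed.

Lemma continuous_sector_arg (B : R) (n : nat) (t x : R) : 0 < x ->
  {for x, continuous (sector_arg alpha B n t)}.
Proof.
move=> x0; apply: (@continuousB _ _ _ (fun x => B * sin t * x `^ alpha)
  (fun=> (n%:R + alpha) / alpha * t)); last exact: cst_continuous.
by apply: (@continuousM _ _ (fun=> B * sin t)); [exact: cst_continuous|exact: continuous_powR_gt0].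
Qed.

Lemma continuous_expR_powR (k x : R) : 0 < x ->
  {for x, continuous (fun y : R => expR (k * y `^ alpha))}.
Proof.
move=> x0; apply: continuous_comp; last exact: continuous_expR.
by apply: (@continuousM _ _ (fun=> k)); [exact: cst_continuous|exact: continuous_powR_gt0].
Qed.

Lemma continuous_sector_fun (B : R) (n : nat) (t x : R) : 0 < x ->
  {for x, continuous (sector_fun alpha B n t)}.
Proof.
move=> x0; apply: (@continuousM _ _ (fun x : R => x ^+ n * x `^ (alpha - 1))
  (fun x => expR (- (B * cos t) * x `^ alpha) * sin (sector_arg alpha B n t x))).
  by apply: continuousM; [exact: exprn_continuous|exact: continuous_powR_gt0].
apply: continuousM; first exact: continuous_expR_powR.
apply: (@continuous_comp _ _ _ (sector_arg alpha B n t) sin); last exact: continuous_sin.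
exact: continuous_sector_arg.
Qed.

Lemma continuous_sector_dfun (B : R) (n : nat) (t x : R) : 0 < x ->
  {for x, continuous (sector_dfun alpha B n t)}.
Proof.
move=> x0; apply: (@continuousM _ _ (fun x : R => x ^+ n * x `^ (alpha - 1))
  (fun x => expR (- (B * cos t) * x `^ alpha) *
   (B * x `^ alpha * sin t * sin (sector_arg alpha B n t x) +
    (B * x `^ alpha * cos t - (n%:R + alpha) / alpha) * cos (sector_arg alpha B n t x)))).
  by apply: continuousM; [exact: exprn_continuous|exact: continuous_powR_gt0].
apply: continuousM; first exact: continuous_expR_powR.
have cu : {for x, continuous (fun y : R => B * y `^ alpha)}.
  by apply: (@continuousM _ _ (fun=> B)); [exact: cst_continuous|exact: continuous_powR_gt0].
apply: continuousD; apply: continuousM.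
- by apply: continuousM => //; exact: cst_continuous.
- apply: (@continuous_comp _ _ _ (sector_arg alpha B n t) sin); last exact: continuous_sin.
  exact: continuous_sector_arg.
- apply: continuousB; last exact: cst_continuous.
  by apply: continuousM => //; exact: cst_continuous.
- apply: (@continuous_comp _ _ _ (sector_arg alpha B n t) cos); last exact: continuous_cos.
  exact: continuous_sector_arg.
Qed.

Lemma measurable_gt0_continuous (f : R -> R) :
  (forall x : R, 0 < x -> {for x, continuous f}) -> measurable_fun D (f : T -> R).
Proof.
move=> cf; apply: open_continuous_measurable_fun; first exact: interval_open.
by move=> x; rewrite inE/= in_itv/= andbT; exact: cf.
Qed.

Lemma sector_fun_le (B k : R) (n : nat) (t x : R) : k <= B * cos t -> 0 < x ->
  `|sector_fun alpha B n t x| <= 1 * lindley_weight alpha k n x.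
Proof.
move=> kB x0; rewrite mul1r /sector_fun /lindley_weight -!mulrA normrM.
rewrite ger0_norm ?exprn_ge0 ?(ltW x0)// ler_wpM2l ?exprn_ge0 ?(ltW x0)//.
rewrite normrM (ger0_norm (powR_ge0 _ _)) mulrCA ler_wpM2l ?powR_ge0//.
have u0 : 0 <= x `^ alpha by exact: powR_ge0.
rewrite normrM (ger0_norm (expR_ge0 _)) mulrC.
apply: ler_pM; rewrite ?expR_ge0 ?normr_ge0//.
  by rewrite (le_trans (sin_max _))// lerDl.
by rewrite ler_expR ler_wpM2r// lerN2.
Qed.

(** With sines and cosines bounded by 1, the bracket is at most B u + (B u + s) <= (2 B + s) (1 +
    u). The bound depends on t only through k <= B cos t, so one dominating function serves a whole
    interval of t. *)
Lemma sector_dfun_le (B k : R) (n : nat) (t x : R) : 0 <= B -> k <= B * cos t -> 0 < x ->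
  `|sector_dfun alpha B n t x| <=
  (2 * B + (n%:R + alpha) / alpha) * lindley_weight alpha k n x.
Proof.
move=> B0 kB x0; rewrite /sector_dfun /lindley_weight.
have u0 : 0 <= x `^ alpha by exact: powR_ge0.
set u := x `^ alpha in u0 *.
have PV0 : 0 <= x ^+ n * x `^ (alpha - 1) by rewrite mulr_ge0 ?powR_ge0 ?exprn_ge0 ?(ltW x0).
rewrite [leRHS](_ : _ = x ^+ n * x `^ (alpha - 1) *
  (expR (- k * u) * ((2 * B + (n%:R + alpha) / alpha) * (1 + u)))); last by ring.
rewrite normrM (ger0_norm PV0) ler_wpM2l// normrM (ger0_norm (expR_ge0 _)).
apply: ler_pM; rewrite ?expR_ge0 ?normr_ge0//.
  by rewrite ler_expR ler_wpM2r// lerN2.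
have s0 : 0 <= (n%:R + alpha) / alpha by rewrite divr_ge0 ?addr_ge0// ltW.
set s := (n%:R + alpha) / alpha in s0 *.
set ph := sector_arg _ _ _ _ _.
have Bu : 0 <= B * u by exact: mulr_ge0.
apply: (le_trans (ler_normD _ _)).
apply: (@le_trans _ _ (B * u + (B * u + s))); last by nra.
have n1 (a b c : R) : `|a| <= c -> `|b| <= 1 -> `|a * b| <= c.
  move=> ac b1; rewrite normrM -[leRHS]mulr1; exact: ler_pM.
apply: lerD; last apply: (n1 _ _ _ _ (cos_max _)).
  apply: (n1 _ _ _ _ (sin_max _)); apply: (n1 _ _ _ _ (sin_max _)).
  by rewrite ger0_norm.
apply: (le_trans (ler_normB _ _)); rewrite (ger0_norm s0) lerD2r.
apply: (n1 _ _ _ _ (cos_max _)).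
by rewrite ger0_norm.
Qed.
End sector_integral.

Section sector_vanishing.
Context {R : realType}.
Variables (alpha : R) (alpha_gt0 : 0 < alpha).
Local Notation mu := (@lebesgue_measure R).
Local Notation T := (measurableTypeR R).
Local Notation D := (`]0%R, +oo[%classic : set T).

(** The comparison of the densities with parameters 2 k and k, divided by their common factor (1 +
    x^alpha) x^(alpha - 1) exp (- k x^alpha). *)
Lemma exprn_expR_powR_bounded (k : R) (n : nat) : 0 < k ->
  exists2 C : R, 0 <= C & forall x : R, 0 < x -> x ^+ n * expR (- k * x `^ alpha) <= C.
Proof.
move=> k0; have k20 : 0 < 2 * k by rewrite mulr_gt0.
have [C C0 hC] := power_lindley_pdf_moment_bound n alpha_gt0 k20.
have k2 : 2 * k / 2 = k by field.
pose K b : R := alpha * b ^+ 2 / (b + 1).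
have K0 b : 0 < b -> 0 < K b.
  by move=> ?; rewrite /K divr_gt0 ?mulr_gt0 ?exprn_gt0 ?addr_gt0.
exists (C * (K k / K (2 * k))); first by rewrite mulr_ge0// divr_ge0// ltW// K0.
move=> x x0; have := hC x; rewrite k2 /power_lindley_pdf x0 gtr0_norm// -/(K k) -/(K (2 * k)).
have Kk := K0 _ k20; clearbody K => h; rewrite mulrA ler_pdivlMr//; move: h.
set u := x `^ alpha; set v := x `^ (alpha - 1).
have u0 : 0 <= u by exact: powR_ge0.
have v0 : 0 < v by exact: powR_gt0.
have p0 : 0 < (1 + u) * v * expR (- k * u) by rewrite !mulr_gt0 ?expR_gt0// ltr_wpDr.
have -> : expR (- (2 * k) * u) = expR (- k * u) * expR (- k * u).
  by rewrite -expRD; congr expR; ring.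
move=> h; rewrite -(ler_pM2r p0).
rewrite [leLHS](_ : _ =
  x ^+ n * (K (2 * k) * (1 + u) * v * (expR (- k * u) * expR (- k * u)))); last by ring.
by rewrite [leRHS](_ : _ = C * (K k * (1 + u) * v * expR (- k * u))); last by ring.
Qed.

Lemma sector_prim_le (B k : R) (n : nat) (t x : R) : k <= B * cos t -> 0 < x ->
  `|sector_prim alpha B n t x| <= x ^+ n * x `^ alpha * expR (- k * x `^ alpha).
Proof.
move=> kB x0; rewrite /sector_prim normrM.
have u0 : 0 <= x `^ alpha by exact: powR_ge0.
rewrite ger0_norm; last by rewrite mulr_ge0 ?exprn_ge0 ?(ltW x0).
rewrite ler_wpM2l; [by []|by rewrite mulr_ge0 ?exprn_ge0 ?(ltW x0)|].
rewrite normrM (ger0_norm (expR_ge0 _)) -[leRHS]mulr1.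
apply: ler_pM; rewrite ?expR_ge0 ?normr_ge0 ?cos_max//.
by rewrite ler_expR ler_wpM2r// lerN2.
Qed.

Lemma cvg_inv_natSS : (m.+2%:R^-1 : R) @[m --> \oo] --> (0 : R).
Proof.
apply: (squeeze_cvgr _ (cvg_cst 0) (@cvg_harmonic R)); apply: nearW => m.
by rewrite invr_ge0 ler0n/= lef_pV2 ?posrE// ler_nat.
Qed.

Lemma cvg_sector_prim0 (B k : R) (n : nat) (t : R) : 0 < k -> k <= B * cos t ->
  sector_prim alpha B n t m.+2%:R^-1 @[m --> \oo] --> (0 : R).
Proof.
move=> k0 kB; apply: norm_cvg0.
have x0 m : 0 < m.+2%:R^-1 :> R by rewrite invr_gt0.
have h : (m.+2%:R^-1 : R) `^ alpha @[m --> \oo] --> (0 : R).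
  have /cvg_at_rightP := powR_cvg0 alpha_gt0; apply; split => //.
  exact: cvg_inv_natSS.
apply: (squeeze_cvgr _ (cvg_cst 0) h); apply: nearW => m; rewrite normr_ge0/=.
apply: (le_trans (sector_prim_le _ kB (x0 m))).
have u0 : 0 <= (m.+2%:R^-1 : R) `^ alpha by exact: powR_ge0.
rewrite -mulrA mulrCA -[leRHS]mulr1 ler_wpM2l// mulr_ile1 ?expR_ge0 ?exprn_ge0 ?(ltW (x0 m))//.
  by rewrite exprn_ile1 ?(ltW (x0 m))// invf_le1// ler1n.
by rewrite -expR0 ler_expR mulNr oppr_le0 mulr_ge0// ltW.
Qed.

(** For x >= 1 and alpha <= 1, x^alpha <= x; the boundedness of x^(n+2) exp (- k x^alpha) then gives
    a bound C / x. *)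
Lemma cvg_sector_primy (B k : R) (n : nat) (t : R) : alpha <= 1 -> 0 < k -> k <= B * cos t ->
  sector_prim alpha B n t m.+2%:R @[m --> \oo] --> (0 : R).
Proof.
move=> a1 k0 kB; apply: norm_cvg0.
have [C C0 hC] := exprn_expR_powR_bounded n.+2 k0.
have h : C * m.+2%:R^-1 @[m --> \oo] --> (0 : R).
  rewrite -(mulr0 C); apply: cvgM; first exact: cvg_cst.
  exact: cvg_inv_natSS.
apply: (squeeze_cvgr _ (cvg_cst 0) h); apply: nearW => m; rewrite normr_ge0/=.
have x0 : 0 < m.+2%:R :> R by [].
apply: (le_trans (sector_prim_le _ kB x0)).
rewrite ler_pdivlMr//; apply: le_trans (hC _ x0); set x := m.+2%:R.
rewrite mulrAC ler_wpM2r ?expR_ge0// -mulrA -addn2 exprD ler_wpM2l ?exprn_ge0 ?(ltW x0)//.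
rewrite expr2 ler_wpM2r ?(ltW x0)// -[leRHS](powRr1 (ltW x0)).
by apply: ler_powR => //; rewrite /x ler1n.
Qed.

Lemma sector_dfun_integral0 (B k : R) (n : nat) (t : R) : alpha <= 1 ->
  0 <= B -> 0 < k -> k <= B * cos t ->
  \int[mu]_(x in D) sector_dfun alpha B n t x = 0.
Proof.
move=> a1 B0 k0 kB.
have mD : measurable D by exact: measurable_itv.
have idf : mu.-integrable D (EFin \o sector_dfun alpha B n t).
  apply: (integrable_lindley_dominated alpha_gt0 k0).
    by apply: measurable_gt0_continuous => x; exact: continuous_sector_dfun.
  by move=> x x0; apply: (sector_dfun_le alpha_gt0 _ B0 kB x0).
suff : \int[mu]_(x in D) (- alpha * sector_dfun alpha B n t x) = 0.
  rewrite RintegralZl// => /eqP; rewrite mulf_eq0 oppr_eq0 (gt_eqF alpha_gt0).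
  by move=> /eqP.
apply: (@integral0y_derive_eq0 _ _ (sector_prim alpha B n t)).
- by move=> x x0; exact: is_derive_sector_prim.
- move=> x x0; apply: (@continuousM _ _ (fun=> - alpha)); first exact: cst_continuous.
  exact: continuous_sector_dfun.
- by have := integrableZl mD (- alpha) idf; apply: eq_integrable.
- exact: cvg_sector_prim0 k0 kB.
- exact: cvg_sector_primy k0 kB.
Qed.

(** As a function of t the integral has derivative 0, and at t = 0 the sine in the integrand
    vanishes. *)
Lemma sector_integral0 (B : R) (n : nat) (t : R) : alpha <= 1 -> 0 < B ->
  0 <= t < pi / 2 -> \int[mu]_(x in D) sector_fun alpha B n t x = 0.
Proof.
move=> a1 B0 /andP[t0 tpi].
have mD : measurable D by exact: measurable_itv.
(* Midway between t and pi/2, so that B cos s >= B cos t1 > 0 for all |s| < t1. The symmetric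
   interval has both 0 and t in its interior. *)
pose t1 := (t + pi / 2) / 2.
have tt1 : t < t1 by rewrite /t1; lra.
have t1pi : t1 < pi / 2 by rewrite /t1; lra.
have t10 : 0 < t1 by exact: le_lt_trans tt1.
pose k := B * cos t1.
have k0 : 0 < k.
  rewrite mulr_gt0// cos_gt0_pihalf// t1pi andbT.
  by rewrite (lt_trans _ t10)// oppr_lt0 divr_gt0// pi_gt0.
have kB s : `]-t1, t1[%classic s -> k <= B * cos s.
  rewrite /= in_itv/= => st1; rewrite ler_pM2l// -[leRHS]cos_norm.
  have st : `|s| < t1 by rewrite ltr_norml.
  have := pi_gt0 R => pi0.
  by rewrite leNgt ltr_cos ?in_itv/= ?normr_ge0 -?leNgt ?(ltW st)//; apply/andP; split; lra.
pose F s := \int[mu]_(x in D) sector_fun alpha B n s x.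
have intf s : `]-t1, t1[%classic s -> mu.-integrable D (EFin \o sector_fun alpha B n s).
  move=> /kB ks; apply: (integrable_lindley_dominated alpha_gt0 k0 _
    (fun x x0 => sector_fun_le alpha n ks x0)).
  by apply: measurable_gt0_continuous => x; exact: continuous_sector_fun.
pose C := 2 * B + (n%:R + alpha) / alpha.
have iW : mu.-integrable D (EFin \o (fun x => `|C * lindley_weight alpha k n x|)).
  have := integrableZl mD C (integrable_lindley_weight alpha_gt0 n k0).
  move=> /integrable_norm; exact.
have dE s x : partial1of2 (sector_fun alpha B n) s x = sector_dfun alpha B n s x.
  have ds := is_derive_sector_fun alpha B n s x.
  by rewrite /partial1of2 derive1E derive_val.
have der s x : `]-t1, t1[%classic s -> D x -> derivable (sector_fun alpha B n ^~ x) s 1.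
  by move=> _ _; have [] := is_derive_sector_fun alpha B n s x.
have bnd s x : `]-t1, t1[%classic s -> D x ->
    `|partial1of2 (sector_fun alpha B n) s x| <= `|C * lindley_weight alpha k n x|.
  move=> /kB ks; rewrite /= in_itv/= andbT => x0; rewrite dE.
  exact: le_trans (sector_dfun_le alpha_gt0 n (ltW B0) ks x0) (ler_norm _).
have dF s : `]-t1, t1[%classic s -> is_derive s (1 : R) F 0.
  move=> sI; apply: DeriveDef.
    exact: (derivable_under_integral mD sI intf der (fun=> normr_ge0 _) iW bnd).
  rewrite -derive1E (differentiation_under_integral mD sI intf der (fun=> normr_ge0 _) iW bnd).
  under eq_Rintegral do rewrite dE.
  by rewrite (sector_dfun_integral0 _ a1 (ltW B0) k0 (kB _ sI)).
have F0 : F 0 = 0.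
  rewrite /F (_ : \int[mu]_(x in D) _ = \int[mu]_(x in D) 0); last first.
    apply: eq_Rintegral => x _; rewrite /sector_fun /sector_arg sin0.
    by rewrite !(mulr0, mul0r) subrr sin0 !mulr0.
  by rewrite Rintegral_cst// mul0r.
have [->//|tN0] := eqVneq t 0.
have {tN0}t_gt0 : 0 < t by rewrite lt_neqAle eq_sym tN0.
have I0 s : s \in `[0, t] -> `]-t1, t1[%classic s.
  by rewrite in_itv/= => /andP[s0 st]; rewrite /= in_itv/=; apply/andP; split; lra.
have dF0 s : s \in `]0, t[ -> is_derive s (1 : R) F 0.
  by move=> sI; apply: dF; apply: I0; exact: subset_itv_oo_cc.
have cF : {within `[0, t], continuous F}.
  by apply: derivable_within_continuous => s /I0 /dF[].
have [c _] := MVT t_gt0 dF0 cF.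
by rewrite F0 mul0r subr0.
Qed.

End sector_vanishing.

(** * The case alpha < 1/2 *)

(* The hypotheses on the density are arguments so that the probability instance
   below can be inferred. *)
Definition density_measure (R : realType) (d : R -> R) (d_ge0 : forall x, 0 <= d x)
    (d_meas : measurable_fun [set: measurableTypeR R] (d : measurableTypeR R -> R))
    (d_int : (\int[lebesgue_measure]_(x in [set: measurableTypeR R]) (d x)%:E = 1)%E) :
    set (measurableTypeR R) -> \bar R :=
  fun A => (\int[lebesgue_measure]_(x in A) (d x)%:E)%E.

Section density_probability.
Context {R : realType} (d : R -> R).
Hypothesis d_ge0 : forall x, 0 <= d x.
Hypothesis d_meas : measurable_fun [set: measurableTypeR R] (d : measurableTypeR R -> R).
Hypothesis d_int : (\int[lebesgue_measure]_(x in [set: measurableTypeR R]) (d x)%:E = 1)%E.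
Local Notation dm := (density_measure d_ge0 d_meas d_int).

Let density0 : dm set0 = 0%E.
Proof. by rewrite /density_measure integral_set0. Qed.

Let density_measure_ge0 A : (0 <= dm A)%E.
Proof. by apply: integral_ge0 => x _; rewrite lee_fin. Qed.

Let density_sigma_additive : semi_sigma_additive dm.
Proof.
move=> /= F mF tF mUF; rewrite /density_measure; apply: cvg_toP.
  apply: ereal_nondecreasing_is_cvgn => m n mn.
  apply: lee_sum_nneg_natr => // k _ _; apply: integral_ge0 => /= x Fkx.
  by rewrite lee_fin.
rewrite ge0_integral_bigcup//=.
- by apply/measurable_funTS/measurableT_comp.
- by move=> x _; rewrite lee_fin.
Qed.

HB.instance Definition _ := isMeasure.Build _ _ _
  dm density0 density_measure_ge0 density_sigma_additive.

Let density_setT : dm [set: _] = 1%E.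
Proof. exact: d_int. Qed.

HB.instance Definition _ := @Measure_isProbability.Build _ _ R dm density_setT.

End density_probability.

Section integral_density.
Context {R : realType} (M : probability (measurableTypeR R) R) (d : R -> R).
Local Notation mu := (@lebesgue_measure R).
Local Notation T := (measurableTypeR R).
Hypothesis d_ge0 : forall x, 0 <= d x.
Hypothesis d_meas : measurable_fun [set: T] (d : T -> R).
Hypothesis Md : forall A : set T, measurable A -> M A = (\int[mu]_(x in A) (d x)%:E)%E.

(** The Radon-Nikodym derivative of M and d have the same integrals over measurable sets, hence
    agree almost everywhere. *)
Lemma ge0_integral_density (f : T -> \bar R) :
  (forall x, 0 <= f x)%E -> measurable_fun [set: T] f ->
  (\int[M]_x f x = \int[mu]_x (f x * (d x)%:E))%E.
Proof.
move=> f0 mf.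
have dom : M `<< mu.
  apply/null_content_dominatesP => A mA muA0; rewrite Md//.
  by apply: null_set_integral => //=; apply: measurable_funTS; exact/measurable_EFinP.
rewrite -(Radon_Nikodym_SigmaFinite.change_of_variables dom f0 measurableT mf).
have mpdf : measurable_fun [set: T] (EFin \o d) by exact/measurable_EFinP.
have iRN := Radon_Nikodym_SigmaFinite.f_integrable dom.
apply: ae_eq_integral => //.
- by apply: emeasurable_funM => //; exact: measurable_int iRN.
- exact: emeasurable_funM.
- apply: ae_eqe_mul2l => /=; apply: integral_ae_eq => //=.
  by move=> E _ mE; rewrite -Radon_Nikodym_SigmaFinite.f_integral//; exact: Md.
Qed.

Lemma integral_density (f : R -> R) : measurable_fun [set: T] (f : T -> R) ->
  (\int[M]_x (f x)%:E = \int[mu]_x (f x * d x)%:E)%E.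
Proof.
move=> mf; have mfE : measurable_fun [set: T] (EFin \o f) by exact/measurable_EFinP.
rewrite integralE [RHS]integralE; congr (_ - _)%E.
- rewrite ge0_integral_density//; last exact: measurable_funepos.
  apply: eq_integral => x _; rewrite !funeposE -EFin_max -EFinM -EFin_max.
  by rewrite maxr_pMl// mul0r.
- rewrite ge0_integral_density//; last exact: measurable_funeneg.
  apply: eq_integral => x _; rewrite !funenegE -!EFinN -!EFin_max -EFinM.
  by rewrite maxr_pMl// mul0r mulNr.
Qed.

End integral_density.

Lemma sinBnpi (R : realType) (x : R) (n : nat) : sin (x - n%:R * pi) = (-1) ^+ n * sin x.
Proof.
elim: n => [|n ih]; first by rewrite mul0r subr0 mul1r.
have := sinDpi (x - n.+1%:R * pi).
rewrite (_ : x - n.+1%:R * pi + pi = x - n%:R * pi); last by rewrite -natr1; ring.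
by rewrite ih => h; rewrite exprS mulN1r mulNr h opprK.
Qed.

(** * A perturbation of the density with vanishing moments *)

Section power_lindley_perturbation.
Context {R : realType}.
Variables (alpha beta : R) (alpha_gt0 : 0 < alpha) (beta_gt0 : 0 < beta).
Hypothesis alpha_lt : alpha < 1 / 2.
Local Notation mu := (@lebesgue_measure R).
Local Notation T := (measurableTypeR R).
Local Notation D := (`]0%R, +oo[%classic : set T).
Local Notation PL := (power_lindley alpha beta alpha_gt0 beta_gt0).
Local Notation pdf := (power_lindley_pdf alpha beta).
Let K := alpha * beta ^+ 2 / (beta + 1).

Let K_gt0 : 0 < K.
Proof. by rewrite divr_gt0 ?mulr_gt0 ?exprn_gt0 ?addr_gt0. Qed.

(** The threshold 1/2 enters here: the rotation angle pi alpha must stay below pi/2. *)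
Let theta_bounds : 0 < pi * alpha < pi / 2.
Proof. by rewrite mulr_gt0 ?pi_gt0//= ltr_pM2l ?pi_gt0// -div1r. Qed.

Let cos_theta_gt0 : 0 < cos (pi * alpha).
Proof.
have /andP[t0 t1] := theta_bounds.
by rewrite cos_gt0_pihalf// t1 andbT (lt_trans _ t0)// oppr_lt0 divr_gt0// pi_gt0.
Qed.

(** This is B sin t for t = pi alpha and B = beta / cos t, a choice for which B cos t = beta. *)
Definition lindley_freq : R := beta / cos (pi * alpha) * sin (pi * alpha).

Definition lindley_perturbation (x : R) : R :=
  if 0 < x then x `^ (alpha - 1) * (expR (- beta * x `^ alpha) *
    sin (lindley_freq * x `^ alpha - pi * alpha)) else 0.
Local Notation h := lindley_perturbation.

(** At t = pi alpha the phase s t equals pi alpha + n pi. The shift by n pi only changes the sign,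
    so the same function h serves every n. *)
Let sector_funE (n : nat) (x : R) : 0 < x ->
  (-1) ^+ n * sector_fun alpha (beta / cos (pi * alpha)) n (pi * alpha) x = x ^+ n * h x.
Proof.
move=> x0; rewrite /sector_fun /lindley_perturbation x0 divfK ?gt_eqF// /sector_arg.
rewrite -/lindley_freq.
rewrite (_ : _ - _ / _ * _ = lindley_freq * x `^ alpha - pi * alpha - n%:R * pi); last first.
  by field; rewrite gt_eqF.
rewrite sinBnpi.
rewrite [LHS](_ : _ = x ^+ n * (x `^ (alpha - 1) * (expR (- beta * x `^ alpha) *
    (((-1) ^+ n * (-1) ^+ n) * sin (lindley_freq * x `^ alpha - pi * alpha))))); last by ring.
by rewrite -expr2 sqrr_sign mul1r.
Qed.

Lemma measurable_lindley_perturbation : measurable_fun [set: T] (h : T -> R).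
Proof.
apply: measurable_fun_ifT => //.
  by apply: measurable_fun_ltr; [exact: measurable_cst|exact: measurable_id].
have mp p : measurable_fun [set: T] (fun x : T => x `^ p) by exact: measurable_powR.
apply: measurable_funM => //; apply: measurable_funM.
  by apply: measurableT_comp => //; exact: measurable_funM.
apply: measurableT_comp; first by apply: continuous_measurable_fun; exact: continuous_sin.
by apply: measurable_funB => //; exact: measurable_funM.
Qed.

Lemma lindley_freq_gt0 : 0 < lindley_freq.
Proof.
have /andP[t0 t1] := theta_bounds.
by rewrite mulr_gt0 ?divr_gt0// sin_gt0_pihalf// t0 t1.
Qed.

(** Below this point, where the argument of the sine vanishes, that argument lies in ]-pi/2, 0[. The
    constant sign later shows that the perturbation changes the measure. *)
Lemma lindley_perturbation_lt0 (x : R) :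
  0 < x -> x < (pi * alpha / lindley_freq) `^ alpha^-1 -> h x < 0.
Proof.
move=> x0 xy; have /andP[t0 t1] := theta_bounds.
have w0 := lindley_freq_gt0.
have : x `^ alpha < pi * alpha / lindley_freq.
  have := gt0_ltr_powR alpha_gt0 _ _ xy; rewrite !nnegrE powR_ge0 (ltW x0).
  by move=> /(_ isT isT); rewrite -powRrM mulVf ?gt_eqF// powRr1// divr_ge0// ltW.
rewrite ltr_pdivlMr// mulrC => xt.
rewrite /lindley_perturbation x0 pmulr_rlt0 ?powR_gt0// pmulr_rlt0 ?expR_gt0//.
rewrite -oppr_gt0 -sinN opprB; apply: sin_gt0_pihalf; rewrite subr_gt0 xt/=.
by rewrite (le_lt_trans _ t1)// gerBl mulr_ge0 ?powR_ge0// ltW.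
Qed.

(** Since |sin| <= 1 <= 1 + x^alpha. This keeps the perturbed density nonnegative and h integrable
    against all powers. *)
Lemma lindley_perturbation_le (x : R) : K * `|h x| <= pdf x.
Proof.
rewrite /lindley_perturbation /power_lindley_pdf; case: ifPn => x0; last by rewrite normr0 mulr0.
rewrite -/K; have := K_gt0; move: K => k k0.
rewrite -!mulrA ler_pM2l// normrM (ger0_norm (powR_ge0 _ _)).
rewrite [leRHS]mulrCA ler_wpM2l ?powR_ge0// normrM (ger0_norm (expR_ge0 _)) mulrC.
rewrite ler_wpM2r ?expR_ge0// (le_trans (sin_max _))// lerDl powR_ge0//.
Qed.

Lemma integrable_lindley_perturbation (n : nat) :
  mu.-integrable [set: T] (fun x : T => (x ^+ n * h x)%:E).
Proof.
have := integrable_exprn_power_lindley_pdf alpha_gt0 n beta_gt0.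
move=> /(integrableZl measurableT K^-1); apply: le_integrable => //.
  apply/measurable_EFinP; apply: measurable_funM; first exact: measurable_funX.
  exact: measurable_lindley_perturbation.
move=> x _; rewrite -EFinM lee_fin !normrM mulrCA ler_wpM2l//.
rewrite (gtr0_norm (_ : 0 < K^-1)) ?invr_gt0// ler_pdivlMl//.
exact: le_trans (lindley_perturbation_le x) (ler_norm _).
Qed.

Lemma lindley_perturbation_moment (n : nat) :
  (\int[mu]_(x in [set: T]) (x ^+ n * h x)%:E = 0)%E.
Proof.
have mD : measurable D by exact: measurable_itv.
have ih := integrable_lindley_perturbation n.
have -> : (\int[mu]_(x in [set: T]) (x ^+ n * h x)%:E = \int[mu]_(x in D) (x ^+ n * h x)%:E)%E.
  rewrite [RHS]integral_mkcond; apply: eq_integral => x _.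
  rewrite patchE; case: ifPn => //; rewrite notin_setE/= in_itv/= andbT => /negP x0.
  by rewrite /lindley_perturbation (negbTE x0) mulr0.
have ihD : mu.-integrable D (fun x : T => (x ^+ n * h x)%:E) by exact: integrableS ih.
rewrite -[LHS]fineK; last exact: integrable_fin_num.
congr EFin.
have a1 : alpha <= 1 by move: alpha_lt; lra.
have B0 : 0 < beta / cos (pi * alpha) by exact: divr_gt0.
have t0 : 0 <= pi * alpha < pi / 2 by have /andP[? ->] := theta_bounds; rewrite andbT ltW.
have := sector_integral0 alpha_gt0 n a1 B0 t0.
set g := sector_fun _ _ _ _ => g0.
have gE x : 0 < x -> g x = (-1) ^+ n * (x ^+ n * h x).
  by move=> x0; rewrite -sector_funE// mulrA -expr2 sqrr_sign mul1r.
have : \int[mu]_(x in D) ((-1) ^+ n * (x ^+ n * h x)) = 0.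
  rewrite -[RHS]g0; apply: eq_Rintegral => x; rewrite inE/= in_itv/= andbT => x0.
  by rewrite gE.
rewrite RintegralZl// => /eqP; rewrite mulf_eq0 signr_eq0/= => /eqP.
by [].
Qed.

Definition perturbed_pdf (x : R) : R := pdf x + K * h x.

Lemma perturbed_pdf_ge0 (x : R) : 0 <= perturbed_pdf x.
Proof.
rewrite /perturbed_pdf -lerBlDr sub0r; apply: le_trans (lindley_perturbation_le x).
by rewrite -mulrN ler_pM2l// -normrN ler_norm.
Qed.

Lemma measurable_perturbed_pdf : measurable_fun [set: T] (perturbed_pdf : T -> R).
Proof.
apply: measurable_funD; first exact: measurable_power_lindley_pdf.
by apply: measurable_funM => //; exact: measurable_lindley_perturbation.
Qed.

Lemma integrable_exprn_perturbed_pdf (n : nat) :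
  mu.-integrable [set: T] (fun x : T => (x ^+ n * perturbed_pdf x)%:E).
Proof.
have ip := integrable_exprn_power_lindley_pdf alpha_gt0 n beta_gt0.
have ih := integrable_lindley_perturbation n.
have := integrableD measurableT ip (integrableZl measurableT K ih).
apply: eq_integrable => // x _.
by rewrite /= -EFinM -EFinD /perturbed_pdf; congr EFin; ring.
Qed.

Lemma integral_exprn_perturbed_pdf (n : nat) :
  (\int[mu]_(x in [set: T]) (x ^+ n * perturbed_pdf x)%:E =
   \int[mu]_(x in [set: T]) (x ^+ n * pdf x)%:E)%E.
Proof.
have ip := integrable_exprn_power_lindley_pdf alpha_gt0 n beta_gt0.
have ih := integrable_lindley_perturbation n.
rewrite (_ : (fun x : T => _) = (fun x : T => (x ^+ n * pdf x)%:E + K%:E * (x ^+ n * h x)%:E)%E).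
  rewrite integralD//; last exact: integrableZl.
  by rewrite integralZl// lindley_perturbation_moment mule0 adde0.
by apply/funext => x; rewrite -EFinM -EFinD /perturbed_pdf; congr EFin; ring.
Qed.

Lemma integral_perturbed_pdf : (\int[mu]_(x in [set: T]) (perturbed_pdf x)%:E = 1)%E.
Proof.
rewrite -(@integral_power_lindley_pdf R alpha beta alpha_gt0 beta_gt0).
have := integral_exprn_perturbed_pdf 0.
by under eq_integral do rewrite mul1r; under [X in _ = X -> _]eq_integral do rewrite mul1r.
Qed.

Lemma power_lindley_moment_indeterminate : moment_indeterminate PL.
Proof.
split; first exact: power_lindley_finite_moments.
move=> [_ det].
pose Q : probability (measurableTypeR R) R :=
  density_measure perturbed_pdf_ge0 measurable_perturbed_pdf integral_perturbed_pdf.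
have QE (A : set T) : measurable A -> Q A = (\int[mu]_(x in A) (perturbed_pdf x)%:E)%E by [].
have PE (A : set T) : measurable A -> PL A = (\int[mu]_(x in A) (pdf x)%:E)%E by [].
have mX n : measurable_fun [set: T] (fun x : T => x ^+ n) by exact: measurable_funX.
have Qfin : finite_moments Q.
  move=> n; apply/integrableP; split; first exact/measurable_EFinP.
  rewrite (ge0_integral_density measurable_perturbed_pdf QE)//; last first.
    by apply: measurableT_comp => //; exact/measurable_EFinP.
  have /integrableP[_] := integrable_exprn_perturbed_pdf n.
  apply: le_lt_trans; rewrite le_eqVlt; apply/orP; left; apply/eqP.
  apply: eq_integral => x _; rewrite EFinM abseM.
  by rewrite (gee0_abs (_ : 0 <= (perturbed_pdf x)%:E)%E)// lee_fin perturbed_pdf_ge0.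
have QP n : moment Q n = moment PL n.
  rewrite /moment unlock.
  rewrite (integral_density perturbed_pdf_ge0 measurable_perturbed_pdf QE)//.
  rewrite (integral_density (power_lindley_pdf_ge0 alpha_gt0 beta_gt0)
    (measurable_power_lindley_pdf alpha beta) PE)//.
  exact: integral_exprn_perturbed_pdf.
(* If Q and PL agreed on ]0, y[, h would have integral 0 there although it is negative. *)
pose y := (pi * alpha / lindley_freq) `^ alpha^-1.
have y0 : 0 < y.
  have /andP[t0 _] := theta_bounds.
  by rewrite powR_gt0// divr_gt0// lindley_freq_gt0.
pose A : set T := `]0%R, y[%classic.
have mA : measurable A by exact: measurable_itv.
have hA x : A x -> h x < 0.
  by rewrite /A/= in_itv/= => /andP[x0 xy]; exact: lindley_perturbation_lt0.
have iA (f : R -> R) : mu.-integrable [set: T] (fun x : T => (x ^+ 0 * f x)%:E) ->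
    mu.-integrable A (fun x : T => (f x)%:E).
  move=> /(integrableS measurableT mA (@subsetT _ _)).
  by apply: eq_integrable => // x _; rewrite expr0 mul1r.
have ihA := iA _ (integrable_lindley_perturbation 0).
have ipA := iA _ (integrable_exprn_power_lindley_pdf alpha_gt0 0 beta_gt0).
have hA0 : (\int[mu]_(x in A) (h x)%:E = 0)%E.
  have : (\int[mu]_(x in A) (perturbed_pdf x)%:E = \int[mu]_(x in A) (pdf x)%:E)%E :=
    det Q Qfin QP A mA.
  rewrite (_ : (fun x : T => _) = (fun x : T => (pdf x)%:E + K%:E * (h x)%:E)%E)//.
  rewrite integralD//; last exact: integrableZl.
  rewrite integralZl// -(fineK (integrable_fin_num mA ipA)) -(fineK (integrable_fin_num mA ihA)).
  set s := fine _; set r := fine _; rewrite -EFinM -EFinD => -[/eqP].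
  by rewrite -subr_eq0 addrAC subrr add0r mulf_eq0 (gt_eqF K_gt0) => /eqP ->.
(* On A, |h| = - h, so h vanishes almost everywhere on A. As h < 0 there, A would be null, against
   its length y > 0. *)
have /ae_eq_integral_abs : (\int[mu]_(x in A) `|(h x)%:E| = 0)%E.
  rewrite (@eq_integral _ T R mu A (fun x => - (h x)%:E)%E); last first.
    by move=> x; rewrite inE => /hA hx; rewrite lte0_abs.
  by rewrite integralN ?hA0 ?oppe0//; exact: integrable_add_def.
move=> /(_ mA)[].
  by apply: measurable_funTS; apply/measurable_EFinP; exact: measurable_lindley_perturbation.
move=> N [mN N0 subN].
have AN : A `<=` N.
  move=> x Ax; apply: subN => /= /(_ Ax) /eqP; rewrite eqe => /eqP hx.
  by have := hA x Ax; rewrite hx ltxx.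
have : (mu A <= 0)%E by rewrite -N0 le_measure// inE.
by rewrite /A lebesgue_measure_itv/= lte_fin y0 sube0 lee_fin leNgt y0.
Qed.

End power_lindley_perturbation.

Theorem theorem2p4 (R : realType) (alpha beta : R)
    (alpha_gt0 : 0 < alpha) (beta_gt0 : 0 < beta) :
  moment_indeterminate (power_lindley alpha beta alpha_gt0 beta_gt0) <->
  alpha < 1 / 2.
Proof.
split; last exact: power_lindley_moment_indeterminate.
move=> [_ indet]; rewrite ltNge; apply/negP => alpha_ge.
exact/indet/power_lindley_moment_determinate.
Qed.
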